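(* Let $\lambda>0$, $d\in\mathbb{N}$ and $0\le b<a\le 1$ be such that $\lambda\nu_d\left(1-\sqrt{ab}-\sqrt{(1-a)(1-b)}\right)<1$. Then Exact-Recovery of $G_n\sim\mathcal{G}(\lambda n,a,b,d)$ is not solvable.
   Context: $\nu_d$ is the volume of the unit Euclidean ball in $\mathbb{R}^d$. Let $B_n=[-n^{1/d}/2,n^{1/d}/2]^d$ be equipped with the toroidal metric $\|x-y\|_{\mathcal{T}_n}=\left\|\left(\min(|x_k-y_k|,n^{1/d}-|x_k-y_k|)\right)_{k=1}^d\right\|$, where $\|\cdot\|$ is the Euclidean norm. Let $\phi_n=\{X_1,\dots,X_{N_n}\}$ be a homogeneous Poisson point process of intensity $\lambda$ on $B_n$, so $N_n$ is Poisson with mean $\lambda n$. Give the points i.i.d. uniform $\{-1,+1\}$ community labels $Z_1,\dots,Z_{N_n}$, independent of the locations. The graph $G_n\sim\mathcal{G}(\lambda n,a,b,d)$ has vertex set $\{1,\dots,N_n\}$ and, conditionally on locations and labels, each pair $i\neq j$ is joined independently with probability $a\mathbf{1}_{\|X_i-X_j\|_{\mathcal{T}_n}\le \log(n)^{1/d}}$ if $Z_i=Z_j$ and $b\mathbf{1}_{\|X_i-X_j\|_{\mathcal{T}_n}\le\log(n)^{1/d}}$ if $Z_i\neq Z_j$. Exact-Recovery is solvable if for every $n$ there are $\{-1,+1\}$-valued random variables $(\tau^{(n)}_i)_{i\le N_n}$ which are a deterministic function of $(G_n,\phi_n)$ (locations attached to vertices; the function may depend on the model parameters) such that $\lim_{n\to\infty}\mathbb{P}[\mathcal{O}_n=1]=1$,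 where $\mathcal{O}_n=\frac1{N_n}\left|\sum_{i=1}^{N_n}\tau^{(n)}_iZ_i\right|$ ($\mathcal{O}_n:=1$ if $N_n=0$). *)

(* Defs.v *)
From HB Require Import structures.
From mathcomp Require Import all_boot all_order all_algebra.
From mathcomp Require Import all_classical all_reals all_analysis.

Set Implicit Arguments.
Unset Strict Implicit.
Unset Printing Implicit Defensive.
Import Order.TTheory GRing.Theory Num.Theory.

Local Open Scope classical_set_scope.
Local Open Scope ring_scope.

(* R^d is [d.-tuple (measurableTypeR R)], with the Borel sigma-algebra (the one
   generated by the coordinate projections). *)
Notation euclidean R d := (d.-tuple (measurableTypeR R)).

Definition cons_pair (R : realType) (d : nat)
    (p : measurableTypeR R * euclidean R d) : euclidean R d.+1 :=
  [tuple of p.1 :: p.2].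

Lemma measurable_cons_pair (R : realType) (d : nat) :
  measurable_fun [set: measurableTypeR R * euclidean R d]
    (@cons_pair R d).
Proof. exact: measurable_cons. Qed.

Section lebesgue_step.
Context {R : realType} {d : nat}
  (mu : {sigma_finite_measure set (euclidean R d) -> \bar R}).

Definition lebesgue_step : set (euclidean R d.+1) -> \bar R :=
  pushforward (lebesgue_measure \x mu)%E (@cons_pair R d).

Let measurable_cons_preimage (A : set (euclidean R d.+1)) :
  measurable A -> measurable (@cons_pair R d @^-1` A).
Proof.
by move=> mA; rewrite -[X in measurable X]setTI; exact: measurable_cons_pair.
Qed.

Let lebesgue_step0 : lebesgue_step set0 = 0%E.
Proof. by rewrite /lebesgue_step /pushforward preimage_set0 measure0. Qed.

Let lebesgue_step_ge0 A : (0 <= lebesgue_step A)%E.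
Proof. by rewrite /lebesgue_step /pushforward; exact: measure_ge0. Qed.

Let lebesgue_step_sigma_additive : semi_sigma_additive lebesgue_step.
Proof.
move=> F mF tF mUF; rewrite /lebesgue_step /pushforward preimage_bigcup.
apply: measure_semi_sigma_additive.
- by move=> n; exact: measurable_cons_preimage.
- apply/trivIsetP => /= i j _ _ ij; rewrite -preimage_setI.
  by move/trivIsetP : tF => /(_ _ _ _ _ ij) ->//; rewrite preimage_set0.
- by rewrite -preimage_bigcup; exact: measurable_cons_preimage.
Qed.

HB.instance Definition _ := isMeasure.Build _ _ _ lebesgue_step
  lebesgue_step0 lebesgue_step_ge0 lebesgue_step_sigma_additive.

Lemma sigma_finite_lebesgue_step : sigma_finite setT lebesgue_step.
Proof.
have /sigma_finiteP[F [TF ndF Foo]] := sigma_finiteT (@lebesgue_measure R).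
have /sigma_finiteP[G [TG ndG Goo]] := sigma_finiteT mu.
exists (fun n => (fun x : euclidean R d.+1 => thead x) @^-1` F n `&`
  (fun x : euclidean R d.+1 => [tuple of behead x]) @^-1` G n).
  apply/esym; rewrite -subTset => x _.
  have [n _ Fn] : (\bigcup_i F i) (thead x) by rewrite -TF.
  have [m _ Gm] : (\bigcup_i G i) [tuple of behead x] by rewrite -TG.
  exists (maxn n m) => //; split => /=.
  - by move: Fn; exact/subsetPset/ndF/leq_maxl.
  - by move: Gm; exact/subsetPset/ndG/leq_maxr.
move=> n; have [mF Fn] := Foo n; have [mG Gn] := Goo n; split.
  apply: measurableI; rewrite -[X in measurable X]setTI.
    exact: (measurable_tnth ord0).
  exact: measurable_behead.
rewrite /lebesgue_step /pushforward.
rewrite [X in product_measure1 _ _ X](_ : _ = F n `*` G n).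
  by rewrite product_measure1E// lte_mul_pinfty// ge0_fin_numE.
apply/seteqP; split=> -[x y]; rewrite /= theadE (_ : [tuple of _] = y) //;
  exact/val_inj.
Qed.

HB.instance Definition _ := Measure_isSigmaFinite.Build _ _ _ lebesgue_step
  sigma_finite_lebesgue_step.

End lebesgue_step.

(* Lebesgue measure on R^d: d-fold product of the Lebesgue measure on R. *)
Fixpoint lebesgue_euclidean (R : realType) (d : nat) :
    {sigma_finite_measure set (euclidean R d) -> \bar R} :=
  match d with
  | 0 => \d_([tuple] : euclidean R 0)
  | d'.+1 => lebesgue_step (lebesgue_euclidean R d')
  end.

Definition euclidean_norm (R : realType) (d : nat) (x : euclidean R d) : R :=
  Num.sqrt (\sum_(i < d) (tnth x i : R) ^+ 2).

Definition unit_ball_volume (R : realType) (d : nat) : R :=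
  fine (lebesgue_euclidean R d [set x | euclidean_norm x <= 1]).

Definition torus_side (R : realType) (d n : nat) : R := n%:R `^ (d%:R^-1).

Definition torus_box (R : realType) (d n : nat) : set (euclidean R d) :=
  [set x | forall i, - (torus_side R d n / 2) <= (tnth x i : R)
                                             <= torus_side R d n / 2].
Arguments torus_box : clear implicits.

Definition torus_dist (R : realType) (d n : nat) (x y : euclidean R d) : R :=
  euclidean_norm [tuple
    (let t := `|(tnth x k : R) - (tnth y k : R)| in
     Num.min t (torus_side R d n - t)) : measurableTypeR R | k < d].

(* [poisson_pmf] is not used because it is identically 1 at rate 0. *)
Definition poisson_weight (R : realType) (r : R) (k : nat) : R :=
  r ^+ k / k`!%:R * expR (- r).

Section random_points.
Context {R : realType} {d : nat} {disp : measure_display}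
  {Omega : measurableType disp} (P : probability Omega R)
  (N : Omega -> nat) (X : nat -> Omega -> euclidean R d).

Definition point_count (A : set (euclidean R d)) (w : Omega) : nat :=
  (\sum_(i < N w) nat_of_bool (X i w \in A))%N.

(* {X_0, ..., X_(N-1)} is a homogeneous Poisson point process of intensity
   lambda on the set B of finite volume: numbers of points in pairwise disjoint
   sets are independent and Poisson distributed.  The way in which the points
   are enumerated is left unconstrained; the variables X_i with N <= i play no
   role. *)
Definition poisson_point_process (lambda : R) (B : set (euclidean R d)) :=
  [/\ measurable_fun setT N, (forall i, measurable_fun setT (X i)) &
      forall (m : nat) (A : 'I_m -> set (euclidean R d)) (c : 'I_m -> nat),
        (forall i, measurable (A i)) -> trivIset setT A ->
        P [set w | forall i, point_count (A i) w = c i] =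
        (\prod_(i < m) poisson_weight
           (lambda * fine (lebesgue_euclidean R d (A i `&` B))) (c i))%:E].

Definition locations (k : nat) (w : Omega) : k.-tuple (euclidean R d) :=
  [tuple X i w | i < k].

End random_points.

(* The label +1 is encoded by [true] and the label -1 by [false]. *)
Definition spin (R : realType) (s : bool) : R := if s then 1 else -1.

Definition edge_prob (R : realType) (a b : R) (d n : nat)
    (x y : euclidean R d) (s t : bool) : R :=
  if torus_dist n x y <= ln n%:R `^ (d%:R^-1) then
    if s == t then a else b
  else 0.

(* Conditional probability, given locations x and labels z, that the random
   graph on 'I_k is g; only the values of g on pairs i < j are used. *)
Definition graph_prob (R : realType) (a b : R) (d n k : nat)
    (x : k.-tuple (euclidean R d)) (z : 'I_k -> bool) (g : rel 'I_k) : R :=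
  \prod_(i < k) \prod_(j < k | (i < j)%N)
    (let p := edge_prob a b n (tnth x i) (tnth x j) (z i) (z j) in
     if g i j then p else 1 - p).

(* A random graph with distribution G(lambda n, a, b, d), together with the
   underlying locations and labels.  The vertices are the i < gs_N w.
   [gs_labels] and [gs_edges] describe conditional laws by integrating over the
   events {N = k, X in A} and {N = k, X in A, Z = z}, which generate the
   conditioning sigma-algebras. *)
Record geometric_sbm (R : realType) (n : nat) (lambda a b : R) (d : nat) :=
  GeometricSBM {
  gs_disp : measure_display ;
  gs_Omega : measurableType gs_disp ;
  gs_P : probability gs_Omega R ;
  gs_N : gs_Omega -> nat ;
  gs_X : nat -> gs_Omega -> euclidean R d ;
  gs_Z : nat -> gs_Omega -> bool ;
  gs_E : gs_Omega -> rel nat ;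
  gs_ppp : poisson_point_process gs_P gs_N gs_X lambda (torus_box R d n) ;
  gs_Z_measurable : forall i, measurable_fun setT (gs_Z i) ;
  gs_E_measurable : forall i j, measurable_fun setT (fun w => gs_E w i j) ;
  gs_E_sym : forall w, symmetric (gs_E w) ;
  gs_E_irr : forall w, irreflexive (gs_E w) ;
  gs_labels : forall (k : nat) (A : set (k.-tuple (euclidean R d)))
      (z : 'I_k -> bool), measurable A ->
    gs_P [set w | [/\ gs_N w = k, A (locations gs_X k w) &
                      forall i : 'I_k, gs_Z i w = z i]] =
    ((2^-1 ^+ k)%:E *
     gs_P [set w | gs_N w = k /\ A (locations gs_X k w)])%E ;
  gs_edges : forall (k : nat) (A : set (k.-tuple (euclidean R d)))
      (z : 'I_k -> bool) (g : rel 'I_k), measurable A ->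
    gs_P [set w | [/\ gs_N w = k, A (locations gs_X k w),
                      forall i : 'I_k, gs_Z i w = z i &
                      forall i j : 'I_k, (i < j)%N -> gs_E w i j = g i j]] =
    (\int[gs_P]_(w in [set w | [/\ gs_N w = k, A (locations gs_X k w) &
                                   forall i : 'I_k, gs_Z i w = z i]])
       (graph_prob a b n (locations gs_X k w) z g)%:E)%E }.

Definition overlap (R : realType) (k : nat) (s z : 'I_k -> bool) : R :=
  if k == 0%N then 1
  else k%:R^-1 * `|\sum_(i < k) spin R (s i) * spin R (z i)|.

(* An estimator gets the number k of vertices, the location of each vertex and
   the adjacency relation of the graph. *)
Definition estimator (R : realType) (d : nat) :=
  forall k : nat, k.-tuple (euclidean R d) -> rel 'I_k -> 'I_k -> bool.

Definition measurable_estimator (R : realType) (d : nat)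
    (tau : estimator R d) :=
  forall (k : nat) (g : rel 'I_k) (i : 'I_k),
    measurable_fun setT (fun x : k.-tuple (euclidean R d) => tau k x g i).

Definition estimator_overlap (R : realType) (n : nat) (lambda a b : R)
    (d : nat) (G : geometric_sbm n lambda a b d) (tau : estimator R d)
    (w : gs_Omega G) : R :=
  overlap R
    (tau (gs_N w) (locations (@gs_X _ _ _ _ _ _ G) (gs_N w) w)
         (fun i j : 'I_(gs_N w) => gs_E w i j))
    (fun i : 'I_(gs_N w) => gs_Z i w).

Definition exact_recovery_solvable (R : realType) (lambda a b : R) (d : nat)
    (G : forall n : nat, geometric_sbm n lambda a b d) : Prop :=
  exists2 tau : nat -> estimator R d,
    forall n, measurable_estimator (tau n) &
    (fun n => gs_P (G n) [set w | estimator_overlap (tau n) w = 1])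
      @ \oo --> 1%E.

(* Main.v *)
From HB Require Import structures.
Require Import Defs.
From mathcomp Require Import all_boot all_order all_algebra.
From mathcomp Require Import all_classical all_reals all_analysis.
From mathcomp Require Import measurable_realfun ring lra.

(** The law of the labels is tested at many sites, far apart in the box.  A site
is good when a small cube at its centre contains a single point, the hub, and
the rest of the ball of radius [r + 1] around the centre, [r = (ln n)^(1/d)]
being the connection radius, contains a prescribed number of points.  All the
evidence about the label of a hub sits in its own ball.  Hence, even if a
genie reveals the labels of all other points, the labels of the hubs are
conditionally independent given the graph, and every estimator errs on each of
them with probability at least half the mean of the minimum of the two
likelihoods ([genie_success_le]).

With [m] points in the ball this error is at least
[rho^m * exp (- O(sqrt m))], where
[rho = sqrt (a b) + sqrt ((1 - a) (1 - b))] is the Hellinger affinity of one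
edge observation: the minimum of the two likelihoods is their geometric mean
damped by [exp (- |L| / 2)], [L] the log-likelihood ratio, and under the
weights given by the geometric mean [L] is a sum of [m] bounded symmetric
terms, thus of order [sqrt m] ([min_prod_ge], [fair_mean_rademacher]).

Sites are disjoint, so the Poisson process fills them independently.  A site
has exactly one point in its cube with probability bounded below; the number
of points in the rest of the ball is Poisson of mean
[mu <= lambda nu_d (r + 1)^d], about [lambda nu_d ln n].  Prescribing the
number [m], close to [rho * mu], that dominates the series of
[rho^m * P(Poisson mu = m)] gives an error per site of
[exp (- (1 - rho) mu - O(sqrt mu))] up to a factor polynomial in [mu]
([site_probability_ge]).  By hypothesis [lambda nu_d (1 - rho) < 1], so this
is at least [n^(-1+delta)], whereas a grid provides of the order of
[n / ln n] sites: the product over the sites of the probabilities of success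
tends to 0 ([recovered_le], [success_small]).

No Palm calculus enters, since only the numbers of points in disjoint sets are
used.  The overlap is 1 when the labels are recovered exactly or all reversed;
the second event is exact recovery by the opposite estimator
([success_le]). *)

Set Implicit Arguments.
Unset Strict Implicit.
Unset Printing Implicit Defensive.
Import Order.TTheory GRing.Theory Num.Theory.
Local Open Scope ring_scope.

(** * Averages over independent fair bits *)

Notation bits I := {ffun I -> bool}.

Definition fair_mean (R : realType) (I : finType) (F : bits I -> R) : R :=
  2^-1 ^+ #|I| * \sum_g F g.

Definition xor_bits (I : finType) (c g : bits I) : bits I :=
  [ffun e => c e (+) g e].

Section fair_mean.
Context {R : realType} {I : finType}.
Implicit Types (F G : bits I -> R).

Lemma xor_bitsK (c : bits I) : involutive (xor_bits c).
Proof. by move=> g; apply/ffunP => e; rewrite !ffunE addbA addbb addFb. Qed.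

Lemma eq_fair_mean F G : F =1 G -> fair_mean F = fair_mean G.
Proof. by move=> FG; rewrite /fair_mean (eq_bigr _ (fun g _ => FG g)). Qed.

Lemma fair_mean_xor c F : fair_mean (F \o xor_bits c) = fair_mean F.
Proof.
by rewrite /fair_mean [in RHS](reindex_inj (can_inj (xor_bitsK c))).
Qed.

Lemma mass_bits : 2^-1 ^+ #|I| * (#|{: bits I}|)%:R = 1 :> R.
Proof.
by rewrite card_ffun card_bool natrX -exprMn mulVf ?expr1n// pnatr_eq0.
Qed.

Lemma fair_mean_cst (x : R) : fair_mean (fun _ : bits I => x) = x.
Proof.
by rewrite /fair_mean sumr_const -[x *+ _]mulr_natl mulrA mass_bits mul1r.
Qed.

Lemma fair_meanZ (x : R) F : fair_mean (fun g => x * F g) = x * fair_mean F.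
Proof. by rewrite /fair_mean -mulr_sumr mulrCA. Qed.

Lemma fair_meanD F G :
  fair_mean (fun g => F g + G g) = fair_mean F + fair_mean G.
Proof. by rewrite /fair_mean big_split/= mulrDr. Qed.

Lemma fair_meanB F G :
  fair_mean (fun g => F g - G g) = fair_mean F - fair_mean G.
Proof.
rewrite fair_meanD; congr (_ + _).
by rewrite -mulN1r -fair_meanZ; apply: eq_fair_mean => g; rewrite mulN1r.
Qed.

Lemma fair_mean_sum (K : finType) (P : pred K) (f : K -> bits I -> R) :
  fair_mean (fun g => \sum_(k | P k) f k g) = \sum_(k | P k) fair_mean (f k).
Proof. by rewrite /fair_mean exchange_big/= mulr_sumr. Qed.

Lemma ler_fair_mean F G : (forall g, F g <= G g) -> fair_mean F <= fair_mean G.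
Proof.
move=> FG; rewrite ler_wpM2l ?exprn_ge0 ?invr_ge0 ?ler0n//.
by apply: ler_sum.
Qed.

Lemma fair_mean_ge0 F : (forall g, 0 <= F g) -> 0 <= fair_mean F.
Proof. by move=> F0; rewrite -(fair_mean_cst 0); exact: ler_fair_mean. Qed.

Lemma fair_mean_coord (e : I) (f : bool -> R) :
  fair_mean (fun g => f (g e)) = 2^-1 * (f true + f false).
Proof.
pose c : bits I := [ffun x => x == e].
have E : fair_mean (fun g => f (g e)) = fair_mean (fun g => f (~~ g e)).
  rewrite -(fair_mean_xor c) ; apply: eq_fair_mean => g /=.
  by rewrite !ffunE eqxx addTb.
have : fair_mean (fun g => f (g e)) + fair_mean (fun g => f (~~ g e)) =
    f true + f false.
  rewrite -fair_meanD -[RHS]fair_mean_cst; apply: eq_fair_mean => g.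
  by case: (g e) => //=; rewrite addrC.
rewrite -E; lra.
Qed.

(** Functions of disjoint blocks of bits are independent.  A family [h] of
bit vectors, one for each block, is merged into one vector that reads each
bit in the copy of its block; shifting all copies by [x] shifts the merged
vector by [x], so the merged vector is again uniform, and the mean over [h] of
the product factors by distributivity. *)
Lemma fair_mean_prod (J : finType) (o : I -> J) (f : J -> bits I -> R) :
  (forall j (g h : bits I), (forall e, o e = j -> g e = h e) ->
     f j g = f j h) ->
  fair_mean (fun g => \prod_j f j g) = \prod_j fair_mean (f j).
Proof.
move=> fo.
pose merge (h : {ffun J -> bits I}) : bits I :=
  [ffun e => h (o e) e].
pose shift (x : bits I) (h : {ffun J -> bits I}) :=
  [ffun j => xor_bits x (h j)].
have shiftK x : involutive (shift x).
  by move=> h; apply/ffunP => j; rewrite !ffunE xor_bitsK.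
have merge_shift x h : merge (shift x h) = xor_bits (merge h) x.
  by apply/ffunP => e; rewrite !ffunE addbC.
set F := fun g => _.
have E (x : bits I) :
    \sum_h F (merge h) = \sum_h F (xor_bits (merge h) x).
  rewrite (reindex_inj (can_inj (shiftK x))).
  by apply: eq_bigr => h _; rewrite merge_shift.
have : \sum_h F (merge h) = #|{: {ffun J -> bits I}}|%:R * fair_mean F.
  rewrite -[LHS]fair_mean_cst (eq_fair_mean E) fair_mean_sum mulr_natl.
  rewrite -sumr_const.
  by apply: eq_big => // h _; rewrite -[RHS](fair_mean_xor (merge h)).
rewrite {1}/fair_mean => H.
rewrite /fair_mean big_split/= bigA_distr_bigA/= prodr_const.
rewrite (_ : \sum_(h : {ffun J -> _}) _ = \sum_h F (merge h)); last first.
  apply: eq_bigr => h _; apply: eq_bigr => j _; apply: fo => e <-.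
  by rewrite ffunE.
rewrite H mulrA card_ffun natrX -exprMn.
by rewrite mass_bits expr1n mul1r.
Qed.

Lemma big_prod_option (J : finType) (f : option J -> R) :
  \prod_j f j = f None * \prod_j f (Some j).
Proof.
rewrite (bigD1 None)//=; congr (_ * _).
rewrite (reindex_omap Some id)//=; last by case.
by apply: eq_bigl => j; rewrite eqxx.
Qed.

(** Here the bits outside all blocks, those that [o] sends to [None], feed a
factor of their own. *)
Lemma fair_mean_prod_in (J : finType) (V : {set J}) (o : I -> option J)
    (f0 : bits I -> R) (f : J -> bits I -> R) :
  (forall g h : bits I, (forall e, o e = None -> g e = h e) ->
     f0 g = f0 h) ->
  (forall j (g h : bits I), j \in V ->
     (forall e, o e = Some j -> g e = h e) -> f j g = f j h) ->
  fair_mean (fun g => f0 g * \prod_(j in V) f j g) =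
  fair_mean f0 * \prod_(j in V) fair_mean (f j).
Proof.
move=> o0 oV.
pose F (j : option J) g :=
  if j is Some j then if j \in V then f j g else 1 else f0 g.
transitivity (fair_mean (fun g => \prod_j F j g)).
  by apply: eq_fair_mean => g; rewrite big_prod_option/= -big_mkcond.
rewrite (@fair_mean_prod _ o); last first.
  by move=> [j|]//= g h gh; case: ifPn => // jV; apply: oV.
rewrite big_prod_option/= [in RHS]big_mkcond; congr (_ * _).
apply: eq_bigr => j _.
by rewrite /F; case: ifPn => // _; rewrite fair_mean_cst.
Qed.

Lemma fair_mean_prod1 (E : pred I) (f : I -> bool -> R) :
  fair_mean (fun g => \prod_(e | E e) f e (g e)) =
  \prod_(e | E e) (2^-1 * (f e true + f e false)).
Proof.
under eq_fair_mean do rewrite big_mkcond.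
rewrite (@fair_mean_prod _ id); last by move=> j g h ->.
rewrite [RHS]big_mkcond; apply: eq_bigr => e _.
by case: ifPn => _; rewrite ?fair_mean_coord ?fair_mean_cst.
Qed.

(** Reversing one sign changes the sign of every cross term that involves it,
so only the diagonal survives. *)
Lemma fair_mean_rademacher (K : finType) (Q : pred K) (o : K -> I)
    (c : K -> R) :
  {in Q &, injective o} ->
  fair_mean (fun y => (\sum_(k | Q k) spin R (y (o k)) * c k) ^+ 2) =
  \sum_(k | Q k) c k ^+ 2.
Proof.
move=> oI.
under eq_fair_mean => y do rewrite expr2 big_distrlr/=.
rewrite fair_mean_sum; apply: eq_bigr => k Qk.
rewrite fair_mean_sum (bigD1 k)//=.
have spin2 s : spin R s ^+ 2 = 1.
  by rewrite /spin; case: ifP => _; rewrite ?sqrrN expr1n.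
under eq_fair_mean => y do rewrite -expr2 exprMn spin2 mul1r.
rewrite fair_mean_cst big1 ?addr0// => l /andP[Ql lk].
set F := fun y => _.
pose x0 : bits I := [ffun e => e == o k].
have : fair_mean F = - fair_mean F.
  rewrite -[LHS](fair_mean_xor x0) -mulN1r -fair_meanZ.
  apply: eq_fair_mean => y.
  rewrite /F /= !ffunE eqxx (_ : o l == o k = false) ?addFb; last first.
    by apply/eqP => /oI => /(_ Ql Qk) /eqP; rewrite (negbTE lk).
  by rewrite addTb; case: (y (o k)); rewrite /spin/=; ring.
lra.
Qed.

End fair_mean.

Lemma fair_mean_exchange (R : realType) (I J : finType)
    (F : bits I -> bits J -> R) :
  fair_mean (fun y => fair_mean (F y)) = fair_mean (fun g => fair_mean (F^~ g)).
Proof.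
rewrite /fair_mean -mulr_sumr exchange_big/= mulrCA; congr (_ * _).
by rewrite mulr_sumr.
Qed.

(** * Edge densities and the Hellinger affinity *)

(** With [X] and [Y] the logarithms of the two products, the minimum is
[exp ((X + Y) / 2) * exp (- |X - Y| / 2)], and [1 - (X - Y)^2 / t^2] is
nonpositive as soon as [|X - Y| > t].  When a factor vanishes both sides are
0, so the convention [ln 0 = 0] does no harm. *)
Lemma min_prod_ge (R : realType) (K : finType) (P : pred K) (x y : K -> R)
    (t : R) :
  0 < t -> (forall k, 0 <= x k) -> (forall k, 0 <= y k) ->
  expR (- (t / 2)) * (\prod_(k | P k) Num.sqrt (x k * y k)
    * (1 - (\sum_(k | P k) (ln (x k) - ln (y k))) ^+ 2 / t ^+ 2))
  <= Num.min (\prod_(k | P k) x k) (\prod_(k | P k) y k).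
Proof.
move=> t0 x0 y0; set S := \sum_(k | P k) _.
have [/existsP[k /andP[Pk /eqP xyk]]|] :=
  boolP [exists k, P k && (x k * y k == 0)].
  rewrite (bigD1 k)//= xyk sqrtr0 !mul0r mulr0 le_min.
  by rewrite !prodr_ge0.
rewrite negb_exists => /forallP xyN0.
have xgt0 k : P k -> 0 < x k.
  move=> Pk; rewrite lt_neqAle x0 andbT eq_sym; apply/negP => /eqP xk0.
  by have := xyN0 k; rewrite Pk xk0 mul0r eqxx.
have ygt0 k : P k -> 0 < y k.
  move=> Pk; rewrite lt_neqAle y0 andbT eq_sym; apply/negP => /eqP yk0.
  by have := xyN0 k; rewrite Pk yk0 mulr0 eqxx.
pose X := \sum_(k | P k) ln (x k); pose Y := \sum_(k | P k) ln (y k).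
have -> : \prod_(k | P k) x k = expR X.
  by rewrite expR_sum; apply: eq_bigr => k Pk; rewrite lnK// posrE xgt0.
have -> : \prod_(k | P k) y k = expR Y.
  by rewrite expR_sum; apply: eq_bigr => k Pk; rewrite lnK// posrE ygt0.
have -> : \prod_(k | P k) Num.sqrt (x k * y k) = expR ((X + Y) / 2).
  rewrite /X /Y -big_split/= mulr_suml expR_sum; apply: eq_bigr => k Pk.
  rewrite -{1}(@lnK _ (x k)) ?posrE ?xgt0// -{1}(@lnK _ (y k)) ?posrE ?ygt0//.
  rewrite -expRD {1}(splitr (_ + _)) expRD -expr2 sqrtr_sqr.
  by rewrite ger0_norm// expR_ge0.
have -> : S = X - Y by rewrite /S sumrB.
have [XYt|XYt] := leP ((X - Y) ^+ 2) (t ^+ 2).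
  have t2 : 0 < t ^+ 2 by rewrite exprn_gt0.
  have [h1 h2] : X - Y <= t /\ Y - X <= t.
    have : `|X - Y| <= t.
      by rewrite -(@ler_pXn2r _ 2) ?nnegrE ?real_normK ?num_real//; exact: ltW.
    by rewrite ler_norml => /andP[]; lra.
  have h3 : 1 - (X - Y) ^+ 2 / t ^+ 2 <= 1.
    by rewrite lerBlDr lerDl divr_ge0// sqr_ge0.
  apply: (@le_trans _ _ (expR (- (t / 2)) * expR ((X + Y) / 2))).
    by rewrite ler_wpM2l ?expR_ge0// ler_piMr ?expR_ge0.
  by rewrite -expRD le_min !ler_expR; apply/andP; split; lra.
apply: (@le_trans _ _ 0); last by rewrite le_min !expR_ge0.
rewrite mulr_ge0_le0 ?expR_ge0// mulr_ge0_le0 ?expR_ge0// subr_le0.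
by rewrite ler_pdivlMr ?exprn_gt0// mul1r ltW.
Qed.

Section edge_density.
Context {R : realType} (a b : R).
Hypotheses (b0 : 0 <= b) (ba : b < a) (a1 : a <= 1).

(** The law of one edge, as a density with respect to a fair coin, whence the
factor 2: products of such densities can be averaged with [fair_mean]. *)
Definition edge_dens (r same e : bool) : R :=
  let p := if r then if same then a else b else 0 in
  2 * (if e then p else 1 - p).

Definition hellinger : R := Num.sqrt (a * b) + Num.sqrt ((1 - a) * (1 - b)).

(** A bound for the log-likelihood ratio of one edge.  The convention
[ln 0 = 0] keeps it finite when [b = 0] or [a = 1]. *)
Definition max_llr : R :=
  `|ln (2 * a) - ln (2 * b)| + `|ln (2 * (1 - a)) - ln (2 * (1 - b))|.

Definition llr (r e : bool) : R :=
  ln (edge_dens r true e) - ln (edge_dens r false e).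

Lemma edge_dens_ge0 r s e : 0 <= edge_dens r s e.
Proof.
rewrite /edge_dens; case: r; case: s; case: e => /=; move: b0 ba a1; lra.
Qed.

Lemma edge_dens_far s s' e : edge_dens false s e = edge_dens false s' e.
Proof. by []. Qed.

Lemma edge_dens_avg r s : 2^-1 * (edge_dens r s true + edge_dens r s false) = 1.
Proof. by rewrite /edge_dens; field. Qed.

Lemma sqrtr_double (x y : R) :
  Num.sqrt ((2 * x) * (2 * y)) = 2 * Num.sqrt (x * y).
Proof.
rewrite (_ : _ * _ = 2 ^+ 2 * (x * y)); last by ring.
by rewrite sqrtrM ?exprn_ge0// sqrtr_sqr ger0_norm.
Qed.

Lemma edge_dens_hellinger r :
  2^-1 * (Num.sqrt (edge_dens r true true * edge_dens r false true) +
          Num.sqrt (edge_dens r true false * edge_dens r false false)) =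
  if r then hellinger else 1.
Proof.
rewrite /edge_dens; case: r; rewrite !sqrtr_double -mulrDr mulKf ?pnatr_eq0//.
by rewrite mulr0 sqrtr0 subr0 mulr1 sqrtr1 add0r.
Qed.

Lemma hellinger_ge0 : 0 <= hellinger.
Proof. by rewrite addr_ge0// sqrtr_ge0. Qed.

Lemma hellinger_le1 : hellinger <= 1.
Proof.
have amgm (x y : R) : 0 <= x -> 0 <= y -> Num.sqrt (x * y) <= (x + y) / 2.
  move=> x0 y0; rewrite -(@ler_pXn2r _ 2) ?nnegrE ?sqrtr_ge0//; last lra.
  by rewrite sqr_sqrtr ?mulr_ge0//; have := sqr_ge0 (x - y); nra.
have [? ? ?] := And3 b0 ba a1.
have h1 : Num.sqrt (a * b) <= (a + b) / 2 by apply: amgm; lra.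
have h2 : Num.sqrt ((1 - a) * (1 - b)) <= (1 - a + (1 - b)) / 2.
  by apply: amgm; lra.
rewrite /hellinger; lra.
Qed.

Lemma max_llr_ge0 : 0 <= max_llr.
Proof. by rewrite addr_ge0. Qed.

Lemma llr_sqr r e : llr r e ^+ 2 <= if r then max_llr ^+ 2 else 0.
Proof.
rewrite /llr; case: r => /=; last first.
  by rewrite (edge_dens_far false true) subrr expr0n.
rewrite -[leLHS]real_normK ?num_real// ler_pXn2r ?nnegrE ?max_llr_ge0//.
by rewrite /edge_dens /max_llr; case: e; rewrite ?lerDl ?lerDr.
Qed.

(** A lower bound for the probability of erring on a hub with [m] possible
neighbours.  The square root is the order of the standard deviation of the
log-likelihood ratio; the final [+ 1] keeps the threshold to which that ratio
is compared positive at [m = 0]. *)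
Definition error_bound (m : nat) : R :=
  4^-1 * (hellinger ^+ m * expR (- ((max_llr * Num.sqrt (2 * m%:R) + 1) / 2))).

Lemma error_bound_itv m : 0 <= error_bound m <= 1.
Proof.
have h1 : 0 <= hellinger ^+ m <= 1.
  by rewrite exprn_ge0 ?hellinger_ge0//= exprn_ile1 ?hellinger_ge0 ?hellinger_le1.
have h2 : 0 <= expR (- ((max_llr * Num.sqrt (2 * m%:R) + 1) / 2)) <= 1.
  rewrite expR_ge0/= -expR0 ler_expR oppr_le0 divr_ge0 ?addr_ge0//.
  by rewrite mulr_ge0 ?sqrtr_ge0 ?max_llr_ge0.
rewrite /error_bound; move: h1 h2; set x := _ ^+ _; set y := expR _.
move=> /andP[? ?] /andP[? ?]; apply/andP; split.
  by rewrite !mulr_ge0.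
have : x * y <= 1 by rewrite mulr_ile1. lra.
Qed.

End edge_density.

(** * The genie bound for a fixed configuration of points *)

(** Vertices are the elements of [I], and [q] is the set of pairs whose edge
depends on labels; all other pairs are not joined.  The labels of the set [V]
of hubs are to be guessed.  No two hubs are joined, and each vertex is in the
range of at most one hub, the one that [own] records. *)
Section genie.
Context {R : realType} (a b : R).
Hypotheses (b0 : 0 <= b) (ba : b < a) (a1 : a <= 1).
Context {I : finType} (q : pred (I * I)) (V : {set I}) (own : I -> option I)
  (m : I -> nat).
Hypothesis range_from_hub : forall e, q e -> e.1 \in V ->
  e.2 \notin V /\ own e.2 = Some e.1.
Hypothesis range_to_hub : forall e, q e -> e.2 \in V ->
  e.1 \notin V /\ own e.1 = Some e.2.
Hypothesis q_asym : forall e, q e -> ~~ q (e.2, e.1).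
Hypothesis card_own : forall v, v \in V ->
  (#|[set u | own u == Some v]| <= m v)%N.

Local Notation labels := (bits I).
Local Notation graph := (bits (I * I)).
Local Notation dens := (edge_dens a b).

Let hub (e : I * I) : option I :=
  if e.1 \in V then Some e.1 else if e.2 \in V then Some e.2 else None.

Let leaf (v : I) (e : I * I) : I := if e.1 == v then e.2 else e.1.

(** The likelihood of the edges at the hub [v] when its label is [s].  It
depends on the labels [y] only through vertices owned by [v], because the
density of a pair outside [q] ignores the labels. *)
Let hub_dens (v : I) (s : bool) (y : labels) (g : graph) : R :=
  \prod_(e | hub e == Some v) dens (q e) (s == y (leaf v e)) (g e).

Let rest_dens (y : labels) (g : graph) : R :=
  \prod_(e | hub e == None) dens (q e) (y e.1 == y e.2) (g e).

Let hubP v e : v \in V -> hub e == Some v ->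
  (e.1 = v) \/ [/\ e.1 \notin V, e.1 != v & e.2 = v].
Proof.
move=> vV; rewrite /hub; case: ifPn => [e1 /eqP[]|e1]; first by left.
case: ifPn => // e2 /eqP[<-]; right; split => //.
by apply: contraNneq e1 => ->.
Qed.

Let leafP v e : v \in V -> hub e == Some v -> q e ->
  leaf v e \notin V /\ own (leaf v e) = Some v.
Proof.
move=> vV he qe; rewrite /leaf; have [e1|[e1 e1v e2]] := hubP vV he.
  by rewrite e1 eqxx -e1; apply: range_from_hub => //; rewrite e1.
by rewrite (negbTE e1v) -e2; apply: range_to_hub => //; rewrite e2.
Qed.

Let dens_split (y : labels) (g : graph) :
  \prod_e dens (q e) (y e.1 == y e.2) (g e) =
  rest_dens y g * \prod_(v in V) hub_dens v (y v) y g.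
Proof.
rewrite (partition_big hub predT)//= big_prod_option; congr (_ * _).
rewrite [RHS]big_mkcond; apply: eq_bigr => v _; case: ifPn => vV; last first.
  rewrite big_pred0// => e; apply/negP => /eqP; rewrite /hub.
  case: ifPn => [e1 [E]|_]; first by rewrite -E e1 in vV.
  by case: ifPn => // e2 [E]; rewrite -E e2 in vV.
apply: eq_bigr => e he; rewrite /leaf; have [->|[_ e1 e2]] := hubP vV he.
  by rewrite eqxx.
by rewrite (negbTE e1) e2 eq_sym.
Qed.

Let dens_ext (r s s' e : bool) : (r -> s = s') -> dens r s e = dens r s' e.
Proof. by case: r => // ->. Qed.

Let hub_dens_ge0 v s y g : 0 <= hub_dens v s y g.
Proof. by apply: prodr_ge0 => e _; exact: edge_dens_ge0. Qed.

Let rest_dens_ge0 y g : 0 <= rest_dens y g.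
Proof. by apply: prodr_ge0 => e _; exact: edge_dens_ge0. Qed.

Let hub_dens_ext v s (y z : labels) (g h : graph) : v \in V ->
  (forall u, u \notin V -> own u = Some v -> y u = z u) ->
  (forall e, hub e = Some v -> g e = h e) ->
  hub_dens v s y g = hub_dens v s z h.
Proof.
move=> vV yz gh; apply: eq_bigr => e he; rewrite gh; last exact/eqP.
by apply: dens_ext => qe; have [? ?] := leafP vV he qe; rewrite yz.
Qed.

Let rest_dens_ext (y z : labels) (g h : graph) :
  (forall u, u \notin V -> y u = z u) ->
  (forall e, hub e = None -> g e = h e) ->
  rest_dens y g = rest_dens z h.
Proof.
move=> yz gh; apply: eq_bigr => e he; rewrite gh; last exact/eqP.
congr (dens _ _ _); move: he; rewrite /hub.
by case: ifPn => // e1; case: ifPn => // e2 _; rewrite !yz.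
Qed.

(** The joint density of the edges at [v] and of the event that the more likely
label is the true one; 1/2 is the prior probability of a label. *)
Let best (v : I) (y : labels) (g : graph) : R :=
  2^-1 * Num.max (hub_dens v true y g) (hub_dens v false y g).

(** For a fixed graph the guess [T] is a constant, and given the labels of the
other vertices the labels of the hubs are independent fair bits, each of which
agrees with [T] with probability 1/2. *)
Let genie_bound (T : labels) (g : graph) :
  fair_mean (fun y : labels => (\prod_(v in V) (y v == T v)%:R) *
     (rest_dens y g * \prod_(v in V) hub_dens v (T v) y g)) <=
  fair_mean (fun y : labels => rest_dens y g * \prod_(v in V) best v y g).
Proof.
pose f0 y := rest_dens y g * \prod_(v in V) hub_dens v (T v) y g.
have -> : fair_mean (fun y : labels =>
    (\prod_(v in V) (y v == T v)%:R) * f0 y) =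
    fair_mean f0 * \prod_(v in V) 2^-1.
  under eq_fair_mean do rewrite mulrC.
  rewrite (@fair_mean_prod_in _ _ _ _
    (fun u => if u \in V then Some u else None)).
  - congr (_ * _); apply: eq_bigr => v vV.
    rewrite (fair_mean_coord v (fun x => (x == T v)%:R)).
    by case: (T v); rewrite /= ?addr0 ?add0r mulr1.
  - move=> y z yz; have yz' u : u \notin V -> y u = z u.
      by move=> uV; rewrite yz// (negbTE uV).
    congr (_ * _); first exact: rest_dens_ext.
    by apply: eq_bigr => v vV; apply: hub_dens_ext => // u uV _; exact: yz'.
  - by move=> v y z vV ->//; rewrite vV.
rewrite mulrC -fair_meanZ; apply: ler_fair_mean => y.
rewrite /f0 mulrCA -big_split/= ler_wpM2l// ler_prod// => v vV.
rewrite mulr_ge0 ?invr_ge0 ?ler0n//= /best ler_wpM2l ?invr_ge0 ?ler0n// le_max.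
by case: (T v); rewrite lexx ?orbT.
Qed.

Let fair_mean_best v : v \in V ->
  fair_mean (fun y => fair_mean (best v y)) =
  1 - 2^-1 * fair_mean (fun y => fair_mean (fun g =>
    Num.min (hub_dens v true y g) (hub_dens v false y g))).
Proof.
move=> vV.
have E y g : best v y g = 2^-1 * (hub_dens v true y g + hub_dens v false y g)
   - 2^-1 * Num.min (hub_dens v true y g) (hub_dens v false y g).
  rewrite /best.
  have := addr_max_min (hub_dens v true y g) (hub_dens v false y g).
  by move=> <-; ring.
have D1 s y : fair_mean (hub_dens v s y) = 1.
  rewrite [LHS](fair_mean_prod1 (fun e => hub e == Some v)
    (fun e => dens (q e) (s == y (leaf v e)))).
  by rewrite big1// => e _; exact: edge_dens_avg.
transitivity (fair_mean (fun y : labels => 1 - 2^-1 * fair_mean (fun g =>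
    Num.min (hub_dens v true y g) (hub_dens v false y g)))).
  apply: eq_fair_mean => y; rewrite (eq_fair_mean (E y)) fair_meanB.
  rewrite fair_meanZ fair_meanD !D1 fair_meanZ.
  by congr (_ - _); field.
by rewrite fair_meanB fair_mean_cst fair_meanZ.
Qed.

(** The geometric mean [H] of the two likelihoods does not involve the labels,
and given the graph the log-likelihood ratio [L] is a sum of independent
random signs with bounded coefficients, one for each vertex in the range of
[v].  Its second moment is at most half the square of the threshold [t], so
half of the mean of [H], a power of the Hellinger affinity, survives. *)
Let fair_mean_min v : v \in V ->
  2 * error_bound a b (m v) <=
  fair_mean (fun y => fair_mean (fun g =>
    Num.min (hub_dens v true y g) (hub_dens v false y g))).
Proof.
move=> vV.
pose t : R := max_llr a b * Num.sqrt (2 * (m v)%:R) + 1.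
have t0 : 0 < t by rewrite ltr_wpDl// mulr_ge0 ?sqrtr_ge0// max_llr_ge0.
pose E := [pred e | (hub e == Some v) && q e].
pose rt e g := Num.sqrt (dens (q e) true g * dens (q e) false g).
pose H (g : graph) := \prod_(e | hub e == Some v) rt e (g e).
pose L (y : labels) (g : graph) :=
  \sum_(e | E e) spin R (y (leaf v e)) * llr a b (q e) (g e).
have leaf_inj : {in E &, injective (leaf v)}.
  move=> e e' /andP[he qe] /andP[he' qe']; rewrite /leaf.
  have [e1|[_ e1 e2]] := hubP vV he; have [e1'|[_ e1' e2']] := hubP vV he'.
  - rewrite e1 e1' eqxx => ee'.
    by rewrite (surjective_pairing e) (surjective_pairing e') e1 e1' ee'.
  - rewrite e1 eqxx (negbTE e1') => ee'.
    have := q_asym qe'; rewrite -ee' e2' -e1 -surjective_pairing.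
    by rewrite qe.
  - rewrite e1' eqxx (negbTE e1) => ee'.
    have := q_asym qe; rewrite ee' e2 -e1' -surjective_pairing.
    by rewrite qe'.
  - rewrite (negbTE e1) (negbTE e1') => ee'.
    by rewrite (surjective_pairing e) (surjective_pairing e') e2 e2' ee'.
have cardE : (#|E| <= m v)%N.
  apply: leq_trans (card_own vV); rewrite -(card_in_imset leaf_inj).
  apply: subset_leq_card; apply/fintype.subsetP => u /imsetP[e /andP[he qe] ->].
  by rewrite inE; have [_ ->] := leafP vV he qe.
have minE y g : expR (- (t / 2)) * (H g * (1 - L y g ^+ 2 / t ^+ 2)) <=
    Num.min (hub_dens v true y g) (hub_dens v false y g).
  apply: le_trans (@min_prod_ge _ _ _
    (fun e => dens (q e) (true == y (leaf v e)) (g e))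
    (fun e => dens (q e) (false == y (leaf v e)) (g e)) t t0 _ _);
    [|by move=> e; exact: edge_dens_ge0..].
  rewrite le_eqVlt; apply/orP; left; apply/eqP.
  congr (_ * (_ * (1 - _ ^+ 2 / _))).
    apply: eq_bigr => e _; rewrite /rt; case: (y _) => //=.
    by rewrite mulrC.
  rewrite [RHS](bigID q)/= [X in _ + X]big1 ?addr0; last first.
    move=> e /andP[_ /negbTE ->].
    by rewrite (edge_dens_far _ _ _ (false == y (leaf v e))) subrr.
  apply: eq_bigr => e _; rewrite /llr /spin.
  case: (y _) => /=; first by rewrite mul1r.
  by rewrite mulN1r opprB.
have L2 g : fair_mean (fun y => L y g ^+ 2) <= max_llr a b ^+ 2 * (m v)%:R.
  rewrite fair_mean_rademacher//.
  apply: (@le_trans _ _ (\sum_(e | E e) max_llr a b ^+ 2)).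
    apply: ler_sum => e /andP[_ qe].
    by have := @llr_sqr _ a b (q e) (g e); rewrite qe.
  by rewrite sumr_const mulr_natr ler_wpMn2l // sqr_ge0.
have H0 g : 0 <= H g by apply: prodr_ge0 => e _; exact: sqrtr_ge0.
have bH : fair_mean H = hellinger a b ^+ #|E|.
  rewrite [LHS](fair_mean_prod1 (fun e => hub e == Some v) rt) -prodr_const.
  under eq_bigr => e _ do rewrite /rt edge_dens_hellinger.
  by rewrite big_mkcondr.
apply: le_trans (ler_fair_mean (fun y => ler_fair_mean (minE y))).
rewrite fair_mean_exchange.
have t2 : max_llr a b ^+ 2 * (m v)%:R <= t ^+ 2 / 2.
  have C0 := max_llr_ge0 a b.
  have S0 : 0 <= max_llr a b * Num.sqrt (2 * (m v)%:R).
    by rewrite mulr_ge0 ?sqrtr_ge0.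
  have := @sqr_sqrtr R (2 * (m v)%:R); rewrite mulr_ge0 ?ler0n// => /(_ isT) E2.
  have : (max_llr a b * Num.sqrt (2 * (m v)%:R)) ^+ 2 <= t ^+ 2.
    by rewrite ler_pXn2r ?nnegrE ?(ltW t0)// lerDl.
  rewrite exprMn E2; lra.
apply: (@le_trans _ _
  (fair_mean (fun g => expR (- (t / 2)) * 2^-1 * H g))); last first.
  apply: ler_fair_mean => g.
  have -> : fair_mean (fun y : labels =>
      expR (- (t / 2)) * (H g * (1 - L y g ^+ 2 / t ^+ 2))) =
      expR (- (t / 2)) *
        (H g * (1 - (t ^+ 2)^-1 * fair_mean (fun y => L y g ^+ 2))).
    rewrite !fair_meanZ fair_meanB fair_mean_cst; congr (_ * (_ * (_ - _))).
    by rewrite -fair_meanZ; apply: eq_fair_mean => y; rewrite mulrC.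
  rewrite -mulrA ler_wpM2l ?expR_ge0// mulrC ler_wpM2l//.
  rewrite lerBrDr -lerBrDl (@le_trans _ _ ((t ^+ 2)^-1 * (t ^+ 2 / 2)))//.
    rewrite ler_wpM2l ?invr_ge0 ?sqr_ge0//.
    exact: le_trans (L2 g) t2.
  by rewrite mulKf ?sqrf_eq0 ?gt_eqF//; lra.
rewrite fair_meanZ bH /error_bound -/t.
have : hellinger a b ^+ (m v) <= hellinger a b ^+ #|E|.
  by rewrite ler_wiXn2l ?hellinger_ge0 ?hellinger_le1.
have := expR_ge0 (- (t / 2)); set x := expR _; set p := _ ^+ m v.
set r := _ ^+ _; nra.
Qed.

(** The left-hand side is the probability that a function [T] of the graph
returns the labels: labels are uniform and, given them, the graph has the
product of the densities as density with respect to fair coins.  Once the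
labels are fixed the edges at different hubs are independent; averaging them
out leaves functions of the labels owned by different hubs, which are
independent too. *)
Lemma genie_success_le (T : graph -> labels) :
  2^-1 ^+ #|I| * fair_mean (fun g : graph =>
    \prod_e dens (q e) (T g e.1 == T g e.2) (g e)) <=
  \prod_(v in V) (1 - error_bound a b (m v)).
Proof.
pose W (y : labels) (g : graph) := \prod_e dens (q e) (y e.1 == y e.2) (g e).
have step1 : 2^-1 ^+ #|I| * fair_mean (fun g => W (T g) g) =
    fair_mean (fun g => fair_mean (fun y : labels => (y == T g)%:R * W y g)).
  rewrite -fair_meanZ; apply: eq_fair_mean => g.
  rewrite /(fair_mean (fun y => _)).
  congr (_ * _); rewrite (bigD1 (T g))//= eqxx mul1r big1 ?addr0// => y.
  by move=> /negbTE ->; rewrite mul0r.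
rewrite step1.
have step2 g : fair_mean (fun y : labels => (y == T g)%:R * W y g) <=
    fair_mean (fun y : labels => rest_dens y g * \prod_(v in V) best v y g).
  apply: le_trans (genie_bound (T g) g); apply: ler_fair_mean => y.
  have [->|yT] := eqVneq y (T g).
    by rewrite mul1r big1 ?mul1r /W ?dens_split// => v _; rewrite eqxx.
  rewrite mul0r mulr_ge0 ?prodr_ge0// mulr_ge0// prodr_ge0//.
apply: (le_trans (ler_fair_mean step2)); rewrite fair_mean_exchange.
have step3 (y : labels) :
    fair_mean (fun g => rest_dens y g * \prod_(v in V) best v y g) =
    \prod_(v in V) fair_mean (best v y).
  rewrite (@fair_mean_prod_in _ _ _ _ hub).
  - rewrite [X in X * _](fair_mean_prod1 (fun e => hub e == None)
      (fun e => dens (q e) (y e.1 == y e.2))).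
    by rewrite big1 ?mul1r// => e _; exact: edge_dens_avg.
  - by move=> g h gh; exact: rest_dens_ext.
  - move=> v g h vV gh; rewrite /best; congr (_ * Num.max _ _);
      exact: hub_dens_ext.
rewrite (eq_fair_mean step3).
have := @fair_mean_prod_in R I I V own (fun=> 1)
  (fun v y => fair_mean (best v y)).
rewrite fair_mean_cst mul1r; under eq_fair_mean do rewrite mul1r.
move=> ->//; last first.
  move=> v y z vV yz; apply: eq_fair_mean => g; rewrite /best.
  by congr (_ * Num.max _ _); apply: hub_dens_ext => // u _; exact: yz.
apply: ler_prod => v vV; rewrite fair_mean_best//; apply/andP; split.
  rewrite -fair_mean_best//.
  apply: fair_mean_ge0 => y; apply: fair_mean_ge0 => g.
  by rewrite mulr_ge0 ?invr_ge0 ?ler0n// le_max hub_dens_ge0.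
by have := fair_mean_min vV; lra.
Qed.

End genie.

(** * Volumes of cubes and balls *)

Local Open Scope classical_set_scope.
Local Open Scope ring_scope.

Lemma measurable_affine (R : realType) (s t : R) :
  measurable_fun [set: measurableTypeR R]
    ((fun x => s * x + t) : measurableTypeR R -> measurableTypeR R).
Proof. by apply: measurable_funD => //; apply: measurable_funM. Qed.

(** The rescaled image measure agrees with Lebesgue measure on intervals, and
those determine it. *)
Lemma lebesgue_measure_affine (R : realType) (s t : R)
    (A : set (measurableTypeR R)) : 0 < s -> measurable A ->
  (s%:E * lebesgue_measure ((fun x : R => (s * x + t)%R) @^-1` A))%E =
  lebesgue_measure A.
Proof.
move=> s0 mA; pose f : measurableTypeR R -> measurableTypeR R :=
  fun x => s * x + t.
pose k : {nonneg R} := NngNum (ltW s0).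
pose M0 := pushforward (@lebesgue_measure R) f :
  {measure set (measurableTypeR R) -> \bar R}.
pose M : {measure set (measurableTypeR R) -> \bar R} :=
  mscale k (M0 (@measurable_affine R s t)).
apply/esym; apply: (@lebesgue_measure_unique _ M) => //.
move=> _ [[x y] _ <-]/=; rewrite /mscale/= /pushforward.
rewrite (_ : f @^-1` _ = [set` `](x - t) / s, (y - t) / s]]); last first.
  apply/seteqP; split => z /=; rewrite !in_itv/= /f.
    by rewrite ltr_pdivrMr// ler_pdivlMr// ltrBlDr lerBrDr mulrC.
  by rewrite ltr_pdivrMr// ler_pdivlMr// ltrBlDr lerBrDr mulrC.
rewrite !lebesgue_measure_itv/= !lte_fin ltr_pM2r ?invr_gt0// ltrD2r.
case: ifPn => _; last by rewrite mule0.
by rewrite -!EFinD -EFinM; congr _%:E; field; rewrite gt_eqF.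
Qed.

Lemma measurable_forall d (T : measurableType d) (I : finType)
    (F : I -> set T) :
  (forall i, measurable (F i)) -> measurable [set x | forall i, F i x].
Proof.
move=> mF; rewrite (_ : [set x | _] = \bigcap_(i in setT) F i).
  exact: fin_bigcap_measurable.
by apply/seteqP; split => x /= h i //; exact: h.
Qed.

Lemma measurable_exists d (T : measurableType d) (I : finType)
    (F : I -> set T) :
  (forall i, measurable (F i)) -> measurable [set x | exists i, F i x].
Proof.
move=> mF; rewrite (_ : [set x | _] = \bigcup_(i in setT) F i).
  exact: fin_bigcup_measurable.
by apply/seteqP; split => x /= [i]; exists i.
Qed.

Section euclidean_volume.
Context {R : realType}.

Definition affine d (s : R) (t x : euclidean R d) : euclidean R d :=
  [tuple s * (tnth x i : R) + (tnth t i : R) : measurableTypeR R | i < d].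

Lemma measurable_affine_tuple d s (t : euclidean R d) :
  measurable_fun setT (affine s t).
Proof.
apply/measurable_fun_tnthP => i.
rewrite (_ : _ \o _ =
    (fun x => s * (x : R) + (tnth t i : R)) \o (@tnth _ _)^~ i).
  apply: measurableT_comp; first exact: measurable_affine.
  exact: measurable_tnth.
by apply/funext => x /=; rewrite tnth_mktuple.
Qed.

Lemma measurable_preimage d1 d2 (T1 : measurableType d1)
    (T2 : measurableType d2) (f : T1 -> T2) (A : set T2) :
  measurable_fun setT f -> measurable A -> measurable (f @^-1` A).
Proof. by move=> mf mA; rewrite -[X in measurable X]setTI; exact: mf. Qed.

(** By induction on the dimension: both sides are measures in [A] that agree on
products of a measurable set of reals and one of smaller dimension. *)
Lemma lebesgue_euclidean_affine d (s : R) (t : euclidean R d)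
    (A : set (euclidean R d)) : 0 < s -> measurable A ->
  ((s ^+ d)%R%:E * lebesgue_euclidean R d (affine s t @^-1` A))%E =
  lebesgue_euclidean R d A.
Proof.
move=> s0; elim: d t A => [|d IH] t A mA.
  have -> : affine s t = id by apply/funext => x; rewrite (tuple0 x) tuple0.
  by rewrite expr0 mul1e.
pose t1 : R := thead t; pose t2 : euclidean R d := [tuple of behead t].
pose mu := lebesgue_euclidean R d.
pose f (p : measurableTypeR R * euclidean R d) :
    measurableTypeR R * euclidean R d := (s * (p.1 : R) + t1, affine s t2 p.2).
have mf : measurable_fun setT f.
  apply: measurable_fun_pair.
    exact: (measurableT_comp (@measurable_affine R s t1)).
  exact: (measurableT_comp (@measurable_affine_tuple d s t2)).
pose M0 := pushforward (lebesgue_measure \x mu)%E f :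
  {measure set (measurableTypeR R * euclidean R d) -> \bar R}.
have k0 : 0 <= s ^+ d.+1 by rewrite exprn_ge0// ltW.
pose k : {nonneg R} := NngNum k0.
have mA' : measurable (@cons_pair R d @^-1` A).
  by apply: measurable_preimage => //; exact: measurable_cons_pair.
have fE p : cons_pair (f p) = affine s t (cons_pair p).
  case: p => x y; apply/eq_from_tnth => i; rewrite tnth_mktuple/= /cons_pair.
  case: (unliftP ord0 i) => [j|] ->; last by rewrite !tnth0.
  rewrite !tnthS tnth_mktuple; congr (_ + _).
  rewrite /t2 tnth_behead; congr tnth; apply/val_inj => /=.
  by rewrite inordK// ltnS ltn_ord.
have consE : f @^-1` (@cons_pair R d @^-1` A) =
    @cons_pair R d @^-1` (affine s t @^-1` A).
  by apply/seteqP; split => p; rewrite /preimage/= fE.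
rewrite /= /lebesgue_step /pushforward.
pose M : {measure set (measurableTypeR R * euclidean R d) -> \bar R} :=
  mscale k (M0 mf).
have ME X : M X = ((s ^+ d.+1)%:E * (lebesgue_measure \x mu) (f @^-1` X))%E.
  by [].
rewrite [RHS](@product_measure_unique _ _ _ _ _ lebesgue_measure mu M)//.
  by rewrite ME consE.
move=> B C mB mC; rewrite ME.
rewrite (_ : f @^-1` _ = ((fun x : R => s * x + t1) @^-1` B) `*`
    (affine s t2 @^-1` C)); last by apply/seteqP; split => -[x y].
rewrite product_measure1E//; last 2 first.
- by apply: measurable_preimage => //; exact: measurable_affine.
- by apply: measurable_preimage => //; exact: measurable_affine_tuple.
rewrite exprS EFinM muleACA (@lebesgue_measure_affine _ s t1)//.
by rewrite IH.
Qed.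

End euclidean_volume.

Section volumes.
Context {R : realType}.

Definition cube d (c : euclidean R d) (s : R) : set (euclidean R d) :=
  [set x | forall i, (tnth c i : R) <= (tnth x i : R) <= (tnth c i : R) + s].

Definition sqr_dist d (x y : euclidean R d) : R :=
  \sum_(i < d) ((tnth x i : R) - (tnth y i : R)) ^+ 2.

Definition eball d (c : euclidean R d) (rho : R) : set (euclidean R d) :=
  [set x | sqr_dist x c <= rho ^+ 2].

Lemma measurable_pred d (T : measurableType d) (p : T -> bool) :
  measurable_fun setT p -> measurable [set x | p x].
Proof.
move=> mp; have := measurable_preimage mp (_ : measurable [set true]).
by apply.
Qed.

Lemma measurable_coord d (i : 'I_d) :
  measurable_fun setT (fun x : euclidean R d => tnth x i : R).
Proof. exact: measurable_tnth. Qed.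

Lemma measurable_cube d (c : euclidean R d) s : measurable (cube c s).
Proof.
apply: measurable_forall => i; apply: measurable_pred.
apply: measurable_and; apply: measurable_fun_ler => //.
  exact: measurable_coord.
exact: measurable_coord.
Qed.

Lemma measurable_sqr_dist d (c : euclidean R d) :
  measurable_fun setT (fun x : euclidean R d => sqr_dist x c).
Proof.
apply: measurable_sum => i; apply: measurable_funX.
apply: measurable_funB => //.
exact: measurable_coord.
Qed.

Lemma measurable_eball d (c : euclidean R d) rho : measurable (eball c rho).
Proof.
apply: measurable_pred; apply: measurable_fun_ler => //.
exact: measurable_sqr_dist.
Qed.

Lemma lebesgue_cube d (c : euclidean R d) s : 0 < s ->
  lebesgue_euclidean R d (cube c s) = (s ^+ d)%:E.
Proof.
move=> s0; elim: d c => [|d IH] c.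
  rewrite expr0 /= diracE (_ : _ \in _)//.
  by rewrite inE => -[].
rewrite /= /lebesgue_step /pushforward.
rewrite (_ : _ @^-1` _ = [set` `[(thead c : R), (thead c : R) + s]] `*`
    cube [tuple of behead c] s).
  rewrite product_measure1E//; last exact: measurable_cube.
  rewrite IH /= lebesgue_measure_itv/= lte_fin ltrDl s0.
  by rewrite -EFinD -EFinM addrAC subrr add0r exprS.
have E i : tnth c (lift ord0 i) = tnth [tuple of behead c] i.
  rewrite tnth_behead; congr tnth; apply/val_inj => /=.
  by rewrite inordK// ltnS ltn_ord.
apply/seteqP; split => -[x y] /=.
  move=> h; split; first by have := h ord0; rewrite tnth0 in_itv.
  by move=> i; have := h (lift ord0 i); rewrite tnthS E.
rewrite in_itv /= => -[h0 h] i.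
by case: (unliftP ord0 i) => [j|] ->; rewrite ?tnth0// tnthS E.
Qed.

Lemma unit_ball_eball d : [set x : euclidean R d | euclidean_norm x <= 1] =
  eball [tuple 0 : measurableTypeR R | i < d] 1.
Proof.
have E (x : euclidean R d) : sqr_dist x [tuple 0 : measurableTypeR R | i < d]
    = \sum_(i < d) (tnth x i : R) ^+ 2.
  by apply: eq_bigr => i _; rewrite tnth_mktuple subr0.
have S0 (x : euclidean R d) : 0 <= \sum_(i < d) (tnth x i : R) ^+ 2.
  by apply: sumr_ge0 => i _; exact: sqr_ge0.
have sqrt1 (x : R) : 0 <= x -> (Num.sqrt x <= 1) = (x <= 1).
  by move=> x0; rewrite -{1}[1]sqrtr1 ler_sqrt.
by apply/seteqP; split => x /=;
  rewrite /eball /= E expr1n /euclidean_norm sqrt1.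
Qed.

(** This makes the volume of the unit ball finite, so that [fine] does not
truncate it in the definition of [unit_ball_volume]. *)
Lemma eball1_cube d :
  eball [tuple 0 : measurableTypeR R | i < d] 1 `<=`
  cube [tuple (-1) : measurableTypeR R | i < d] 2.
Proof.
move=> x /= + i; rewrite /eball /= /sqr_dist expr1n (bigD1 i)//= !tnth_mktuple.
rewrite subr0; set u : R := tnth x i; set S : R := bigop _ _ _ => uS.
have S0 : 0 <= S by apply: sumr_ge0 => j _; exact: sqr_ge0.
have : `|u| <= 1.
  by rewrite -(@ler_pXn2r _ 2) ?nnegrE// real_normK ?num_real// expr1n; lra.
by rewrite ler_norml => /andP[? ?]; apply/andP; split; lra.
Qed.

Lemma lebesgue_eball d (c : euclidean R d) rho : 0 < rho ->
  lebesgue_euclidean R d (eball c rho) = (unit_ball_volume R d * rho ^+ d)%:E.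
Proof.
move=> rho0; rewrite /unit_ball_volume unit_ball_eball.
set B := eball _ 1.
have mB : measurable B by exact: measurable_eball.
have Bfin : lebesgue_euclidean R d B \is a fin_num.
  rewrite ge0_fin_numE ?measure_ge0//.
  apply: (@le_lt_trans _ _ (lebesgue_euclidean R d
    (cube [tuple (-1) : measurableTypeR R | i < d] 2))).
    by apply: le_measure; rewrite ?inE//;
      [exact: measurable_cube|exact: eball1_cube].
  by rewrite lebesgue_cube// ltry.
pose t : euclidean R d :=
  [tuple - (rho^-1 * (tnth c i : R)) : measurableTypeR R | i < d].
have pre : affine rho^-1 t @^-1` B = eball c rho.
  have E x : sqr_dist (affine rho^-1 t x) [tuple 0 : measurableTypeR R | i < d] =
      sqr_dist x c / rho ^+ 2.
    rewrite /sqr_dist mulr_suml; apply: eq_bigr => i _.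
    by rewrite !tnth_mktuple subr0 -exprVn -exprMn -mulrBr mulrC.
  by apply/seteqP; split => x /=; rewrite /B /eball /= E expr1n ler_pdivrMr
    ?exprn_gt0// mul1r.
have := @lebesgue_euclidean_affine R d rho^-1 t B.
rewrite invr_gt0 pre => /(_ rho0 mB) volE.
rewrite mulrC EFinM (fineK Bfin) -volE muleA -EFinM -exprMn mulfV ?gt_eqF//.
by rewrite expr1n mul1e.
Qed.

Lemma unit_ball_volume_ge0 d : 0 <= unit_ball_volume R d.
Proof. by rewrite fine_ge0// measure_ge0. Qed.

End volumes.

(** * Geometry of the torus *)

Section torus.
Context {R : realType} (d : nat).
Implicit Types x y c : euclidean R d.

Lemma torus_distC n x y : torus_dist n x y = torus_dist n y x.
Proof.
rewrite /torus_dist; congr euclidean_norm; apply: eq_mktuple => i.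
by rewrite distrC.
Qed.

Lemma sqr_coord_le (f : 'I_d -> R) (i : 'I_d) : f i ^+ 2 <= \sum_j f j ^+ 2.
Proof.
by rewrite (bigD1 i)//= lerDl sumr_ge0// => j _; exact: sqr_ge0.
Qed.

Lemma coord_le (f : 'I_d -> R) (r : R) (i : 'I_d) : 0 <= r ->
  \sum_j f j ^+ 2 <= r ^+ 2 -> `|f i| <= r.
Proof.
move=> r0 fr; rewrite -(@ler_pXn2r _ 2) ?nnegrE// real_normK ?num_real//.
exact: le_trans (sqr_coord_le f i) fr.
Qed.

Lemma torus_dist_le n x y r : 0 <= r -> torus_dist n x y <= r ->
  \sum_(i < d) (Num.min `|(tnth x i : R) - (tnth y i : R)|
    (torus_side R d n - `|(tnth x i : R) - (tnth y i : R)|)) ^+ 2 <= r ^+ 2.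
Proof.
move=> r0; rewrite /torus_dist /euclidean_norm.
under eq_bigr do rewrite tnth_mktuple.
set S := \sum_(i < d) _ => Sr.
have S0 : 0 <= S by apply: sumr_ge0 => i _; exact: sqr_ge0.
by rewrite -(sqr_sqrtr S0) ler_pXn2r ?nnegrE ?sqrtr_ge0.
Qed.

Lemma cube_coord c x (i : 'I_d) : cube c d%:R^-1 x ->
  0 <= (tnth x i : R) - (tnth c i : R) <= d%:R^-1.
Proof. by move=> /(_ i)/andP[? ?]; apply/andP; split; lra. Qed.

Lemma invn_le1 (i : 'I_d) : d%:R^-1 <= 1 :> R.
Proof.
have d0 : (0 < d)%N by apply: leq_ltn_trans (ltn_ord i).
by rewrite invf_le1 ?ltr0n// ler1n.
Qed.

(** The side [1/d] is small enough for the diameter of the cube to be at most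
1, by [d * (1/d)^2 <= 1]. *)
Lemma cube_sqr_dist c x : cube c d%:R^-1 x -> sqr_dist x c <= 1.
Proof.
move=> cx; apply: (@le_trans _ _ (\sum_(i < d) d%:R^-1 : R)).
  apply: ler_sum => i _; have /andP[h0 h1] := cube_coord i cx.
  have := invn_le1 i; nra.
rewrite sumr_const card_ord -[leLHS]mulr_natr.
by have [->|d0] := eqVneq d 0%N; rewrite ?mulr0// mulVf ?pnatr_eq0.
Qed.

(** Near the centre of the box the torus looks flat: going round it in some
coordinate costs at least [L / 4 - 1], which exceeds [r]. *)
Lemma torus_near_eball n c x u (r : R) : 0 < r ->
  r + 1 < torus_side R d n / 4 ->
  (forall i, `|(tnth c i : R)| <= torus_side R d n / 4) ->
  cube c d%:R^-1 x -> torus_box R d n u -> torus_dist n x u <= r ->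
  eball c (r + 1) u.
Proof.
set L := torus_side R d n => r0 rL cL cx uB xur.
pose t (i : 'I_d) : R := `|(tnth x i : R) - (tnth u i : R)|.
have /= tr := torus_dist_le (ltW r0) xur.
have tmin i : Num.min (t i) (L - t i) = t i.
  have /andP[x0 x1] := cube_coord i cx; have d1 := invn_le1 i.
  have := cL i; rewrite ler_norml => /andP[c0 c1].
  have /andP[u0 u1] := uB i; rewrite -/L in u0 u1.
  have tL : t i <= L / 4 + 1 + L / 2.
    rewrite /t ler_norml; move: x0 x1 c0 c1 u0 u1 d1; clear.
    set p : R := tnth x i; set q : R := tnth u i; set s : R := tnth c i.
    move=> h1 h2 h3 h4 h5 h6 h7.
    by apply/andP; split; lra.
  have := coord_le i (ltW r0) tr; rewrite -/(t i) /Num.min; case: ifPn => // _.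
  by rewrite ler_norml -/L => /andP[_]; lra.
have {}tr : \sum_(i < d) t i ^+ 2 <= r ^+ 2.
  by apply: le_trans tr; apply: ler_sum => i _; rewrite -/(t i) tmin.
rewrite /eball /=.
have rn0 : r != 0 by rewrite gt_eqF.
(* The inequality (A + B)^2 <= (1 + 1/r) A^2 + (1 + r) B^2, summed over the
   coordinates, replaces the triangle inequality; it is exact for A = r and
   B = 1. *)
apply: (@le_trans _ _ ((1 + r^-1) * \sum_(i < d) t i ^+ 2 +
    (1 + r) * sqr_dist x c)).
  rewrite /sqr_dist !mulr_sumr -big_split/=; apply: ler_sum => i _.
  rewrite /t real_normK ?num_real//.
  set p : R := tnth x i; set q : R := tnth u i; set s : R := tnth c i.
  have -> : (1 + r^-1) * (p - q) ^+ 2 + (1 + r) * (p - s) ^+ 2 =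
      (q - s) ^+ 2 + r^-1 * ((p - q) + r * (p - s)) ^+ 2 by field.
  by rewrite lerDl mulr_ge0 ?sqr_ge0// invr_ge0 ltW.
have xc := cube_sqr_dist cx.
have -> : (r + 1) ^+ 2 = (1 + r^-1) * r ^+ 2 + (1 + r) * 1 by field.
apply: lerD; apply: ler_wpM2l => //; last by rewrite addr_ge0 ?ltW.
by rewrite addr_ge0// invr_ge0 ltW.
Qed.

Lemma cube_eball c rho : 1 <= rho -> cube c d%:R^-1 `<=` eball c rho.
Proof.
move=> rho1 x /cube_sqr_dist/le_trans; apply.
by rewrite -(expr1n _ 2) ler_pXn2r ?nnegrE// (le_trans ler01).
Qed.

Lemma cube_box n c : 1 <= torus_side R d n / 4 ->
  (forall i, `|(tnth c i : R)| <= torus_side R d n / 4) ->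
  cube c d%:R^-1 `<=` torus_box R d n.
Proof.
move=> L4 cL x cx i; have /andP[x0 x1] := cube_coord i cx.
have d1 := invn_le1 i; have := cL i; rewrite ler_norml => /andP[c0 c1].
by apply/andP; split; lra.
Qed.

Lemma eball_disjoint c c' rho (i : 'I_d) x : 0 <= rho ->
  2 * rho < `|(tnth c i : R) - (tnth c' i : R)| ->
  eball c rho x -> eball c' rho x -> False.
Proof.
pose f c0 (i : 'I_d) := (tnth x i : R) - (tnth c0 i : R).
move=> rho0 cc' /(coord_le (f := f c) i rho0) h.
move=> /(coord_le (f := f c') i rho0) h'.
move: cc'; apply/negP; rewrite -leNgt.
move: h h'; rewrite /f !ler_norml => /andP[? ?] /andP[? ?].
by apply/andP; split; lra.
Qed.

Lemma measurable_torus_box n : measurable (torus_box R d n).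
Proof.
apply: measurable_forall => i; apply: measurable_pred.
apply: measurable_and; apply: measurable_fun_ler => //.
  exact: measurable_coord.
exact: measurable_coord.
Qed.

Lemma measurable_torus_dist disp (T : measurableType disp) n
    (f g : T -> euclidean R d) :
  measurable_fun setT f -> measurable_fun setT g ->
  measurable_fun setT (fun w => torus_dist n (f w) (g w)).
Proof.
move=> mf mg; rewrite /torus_dist /euclidean_norm.
have ms : measurable_fun [set: R] (@Num.sqrt R).
  apply: continuous_measurable_fun; exact: sqrt_continuous.
apply: (measurableT_comp ms); apply: measurable_sum => i.
under eq_fun do rewrite tnth_mktuple.
apply: measurable_funX.
have mfi : measurable_fun setT (fun w => tnth (f w) i : R).
  exact: (measurableT_comp (@measurable_coord R d i)).
have mgi : measurable_fun setT (fun w => tnth (g w) i : R).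
  exact: (measurableT_comp (@measurable_coord R d i)).
have ma : measurable_fun setT
    (fun w => `|(tnth (f w) i : R) - (tnth (g w) i : R)|).
  by apply: measurableT_comp => //; exact: measurable_funB.
by apply: measurable_minr => //; exact: measurable_funB.
Qed.

End torus.

(** * From configurations of points to the genie bound *)

Notation edge_bits k := (bits ('I_k * 'I_k)).

(** Graphs on ['I_k] are indexed by the bit vectors that vanish on the pairs
[(i, j)] with [j <= i], which makes the index unique. *)
Definition upper_bits k (g : edge_bits k) : bool :=
  [forall e : 'I_k * 'I_k, g e ==> (e.1 < e.2)%N].

Definition graph_of_bits k (g : edge_bits k) : rel 'I_k :=
  fun i j =>
    if (i < j)%N then g (i, j) else if (j < i)%N then g (j, i) else false.

Definition edge_range (R : realType) (d n : nat) : R := ln n%:R `^ (d%:R^-1).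

Definition in_range (R : realType) (d n k : nat) (x : k.-tuple (euclidean R d))
    (e : 'I_k * 'I_k) : bool :=
  (e.1 < e.2)%N && (torus_dist n (tnth x e.1) (tnth x e.2) <= edge_range R d n).

Definition tuple_count (R : realType) (d k : nat) (A : set (euclidean R d))
    (x : k.-tuple (euclidean R d)) : nat :=
  (\sum_(i < k) nat_of_bool (tnth x i \in A))%N.

(** Pairs [(i, j)] with [j <= i] count as out of range: their density forces
the bit to vanish, so the sum may run over all bit vectors. *)
Lemma sum_graph_prob (R : realType) (a b : R) (d n k : nat)
    (x : k.-tuple (euclidean R d)) (T : edge_bits k -> bits 'I_k) :
  \sum_(g | upper_bits g) graph_prob a b n x (T g) (graph_of_bits g) =
  fair_mean (fun g => \prod_e edge_dens a b (in_range n x e)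
    (T g e.1 == T g e.2) (g e)).
Proof.
rewrite /fair_mean mulr_sumr big_mkcond/=; apply: eq_bigr => g _.
case: ifPn => [/forallP ug|]; last first.
  rewrite negb_forall => /existsP[e]; rewrite negb_imply => /andP[ge elt].
  rewrite (bigD1 e)//= /edge_dens /in_range ge (negbTE elt).
  by rewrite mulr0 mul0r mulr0.
rewrite /edge_dens big_split/= prodr_const mulrA -exprMn mulVf ?pnatr_eq0//.
rewrite expr1n mul1r /graph_prob.
transitivity (\prod_(i < k) \prod_(j < k)
  (let p := if in_range n x (i, j) then if T g i == T g j then a else b else 0 in
   if g (i, j) then p else 1 - p)); last first.
  by rewrite pair_bigA/=; apply: eq_bigr => -[i j].
apply: eq_bigr => i _; rewrite big_mkcond/=; apply: eq_bigr => j _.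
rewrite /in_range /edge_range /graph_of_bits /edge_prob /=.
have [//|ij] := boolP (i < j)%N.
by have := ug (i, j); rewrite (negbTE ij) implybF => /negbTE ->; rewrite subr0.
Qed.

Lemma tuple_countE (R : realType) (d k : nat) (A : set (euclidean R d))
    (x : k.-tuple (euclidean R d)) :
  tuple_count A x = #|[set i : 'I_k | tnth x i \in A]%SET|.
Proof.
rewrite /tuple_count -sum1_card [RHS]big_mkcond/=; apply: eq_bigr => i _.
by rewrite inE; case: (_ \in _).
Qed.

Section located.
Context {R : realType} (a b : R).
Hypotheses (b0 : 0 <= b) (ba : b < a) (a1 : a <= 1).
Context (d n : nat) (J : finType) (c : J -> euclidean R d).
Local Notation r := (edge_range R d n).
Hypothesis r_gt0 : 0 < r.
Hypothesis rL : r + 1 < torus_side R d n / 4.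
Hypothesis cL : forall j i, `|(tnth (c j) i : R)| <= torus_side R d n / 4.
Hypothesis centres_sep : forall j j', j != j' ->
  exists i, 2 * (r + 1) < `|(tnth (c j) i : R) - (tnth (c j') i : R)|.

(** A site is good when its core contains one point, the hub, and its shell a
prescribed number of points.  The shell has to contain every possible
neighbour of the hub, wherever the hub lies in the core. *)
Definition core_cell j := cube (c j) d%:R^-1.
Definition shell_cell j := eball (c j) (r + 1) `\` core_cell j.

Let core_eball j : core_cell j `<=` eball (c j) (r + 1).
Proof. by apply: cube_eball; rewrite lerDr ltW. Qed.

Lemma eball_site_inj j j' u :
  eball (c j) (r + 1) u -> eball (c j') (r + 1) u -> j = j'.
Proof.
move=> uj uj'; apply/eqP/negPn/negP => jj'; have [i ci] := centres_sep jj'.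
by apply: (eball_disjoint _ ci uj uj'); rewrite addr_ge0// ltW.
Qed.

(** The hubs are the points in the cores of the good sites, and each point of
a shell is owned by the hub of its site.  Separation of the centres makes the
balls disjoint, so no two hubs are in range of each other and owners are
unique. *)
Lemma located_success_le k (x : k.-tuple (euclidean R d)) (S : {set J})
    (m : J -> nat) (T : edge_bits k -> bits 'I_k) :
  (forall i, torus_box R d n (tnth x i)) ->
  (forall j, j \in S -> tuple_count (core_cell j) x = 1%N /\
                        tuple_count (shell_cell j) x = m j) ->
  2^-1 ^+ k *
    \sum_(g | upper_bits g) graph_prob a b n x (T g) (graph_of_bits g) <=
  \prod_(j in S) (1 - error_bound a b (m j)).
Proof.
move=> xB xS; rewrite sum_graph_prob -[in 2^-1 ^+ k](card_ord k).
have [->|/set0Pn[j0 j0S]] := eqVneq S (finset.set0 : {set J}).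
  rewrite big_set0; apply: le_trans (@genie_success_le _ _ _ b0 ba a1 _
    (in_range n x) finset.set0 (fun=> None) (fun=> 0%N) _ _ _ _ T) _.
  - by move=> e _; rewrite finset.in_set0.
  - by move=> e _; rewrite finset.in_set0.
  - by move=> e /andP[e12 _]; rewrite /in_range /= ltnNge (ltnW e12).
  - by move=> v; rewrite finset.in_set0.
  - by rewrite big_set0.
have core1 j : j \in S ->
    exists v, [set i | tnth x i \in core_cell j]%SET = [set v]%SET.
  by move=> /xS[+ _]; rewrite tuple_countE => /eqP/cards1P.
have [v0 _] := core1 _ j0S.
pose hub j := odflt v0 [pick v | tnth x v \in core_cell j].
have hubP j v : j \in S -> (tnth x v \in core_cell j) = (v == hub j).
  move=> jS; have [v1 v1P] := core1 j jS.
  have E w : (tnth x w \in core_cell j) = (w == v1).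
    by rewrite -(finset.in_set1 w v1) -v1P finset.in_set.
  rewrite E /hub; case: pickP => [w|/(_ v1)]; first by rewrite E => /eqP ->.
  by rewrite E eqxx.
have hub_core j : j \in S -> core_cell j (tnth x (hub j)).
  by move=> jS; have := hubP j (hub j) jS; rewrite eqxx => /set_mem.
have hub_inj : {in S &, injective hub}.
  move=> j j' jS j'S hh; apply: (@eball_site_inj _ _ (tnth x (hub j))).
    exact/core_eball/hub_core.
  by rewrite hh; exact/core_eball/hub_core.
pose own u := omap hub [pick j | (j \in S) && (tnth x u \in shell_cell j)].
have ownP j u : j \in S -> (own u == Some (hub j)) = (tnth x u \in shell_cell j).
  move=> jS; rewrite /own.
  case: pickP => [j' /andP[j'S uj']|/(_ j)] /=; last by rewrite jS.
  rewrite -[LHS]/(hub j' == hub j) (inj_in_eq hub_inj)//.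
  apply/eqP/idP => [<-//|uj]; apply: (@eball_site_inj _ _ (tnth x u)).
    by move/set_mem : uj' => [].
  by move/set_mem : uj => [].
have near j u : j \in S -> u != hub j ->
    torus_dist n (tnth x (hub j)) (tnth x u) <= r ->
    u \notin [set hub j | j in S]%SET /\ own u = Some (hub j).
  move=> jS uj ur.
  have uball : eball (c j) (r + 1) (tnth x u).
    exact: (torus_near_eball _ _ _ (hub_core j jS) (xB u) ur).
  split; last first.
    apply/eqP; rewrite ownP//; apply/mem_set; split => // /mem_set.
    by rewrite hubP// (negbTE uj).
  apply: contraNN uj => /imsetP[j' j'S uj']; rewrite uj'; apply/eqP; congr hub.
  apply: (@eball_site_inj _ _ (tnth x u)) => //.
  by rewrite uj'; apply: core_eball; exact: hub_core.
apply: le_trans (@genie_success_le _ _ _ b0 ba a1 _ (in_range n x)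
  [set hub j | j in S]%SET own
  (fun v => #|[set u | own u == Some v]%SET|) _ _ _ _ T) _.
- move=> e /andP[e12 er] /imsetP[j jS e1].
  rewrite e1; apply: near => //; last by rewrite -e1.
  by rewrite -e1; apply: contraTneq e12 => ->; rewrite ltnn.
- move=> e /andP[e12 er] /imsetP[j jS e2].
  rewrite e2; apply: near => //; last by rewrite -e2 torus_distC.
  by rewrite -e2; apply: contraTneq e12 => ->; rewrite ltnn.
- by move=> e /andP[e12 _]; rewrite /in_range /= ltnNge (ltnW e12).
- by move=> v _; exact: leqnn.
rewrite big_imset//=; apply: ler_prod => j jS.
have -> : #|[set u | own u == Some (hub j)]%SET| = m j.
  have [_ <-] := xS j jS; rewrite tuple_countE; apply: eq_card => u.
  by rewrite !inE ownP.
by rewrite lexx andbT subr_ge0; have /andP[] := error_bound_itv b0 ba a1 (m j).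
Qed.

End located.

(** * Laws of the points, the labels and the graph *)

Lemma measure_finpart disp (T : measurableType disp) (R : realType)
    (mu : {measure set T -> \bar R}) (F : finType) (h : T -> F) (A : set T) :
  (forall t, measurable (A `&` [set w | h w = t])) ->
  mu A = (\sum_(t : F) mu (A `&` [set w | h w = t]))%E.
Proof.
move=> mh; rewrite fsbig_seq ?index_enum_uniq// -measure_fin_bigcup//.
- congr (mu _); apply/seteqP; split => [w Aw|w [t _ []]//].
  by exists (h w) => //=; rewrite mem_index_enum.
- apply/trivIsetP => t t' _ _ tt'; apply/seteqP; split => // w [[_ ht] [_ ht']].
  by move/eqP : tt'; apply; rewrite -ht -ht'.
Qed.

Lemma prod1D_subsets (R : comPzRingType) (J : finType) (S : {set J})
    (y : J -> R) :
  \prod_(j in S) (1 + y j) =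
  \sum_(S' : {set J} | (S' \subset S)%SET) \prod_(j in S') y j.
Proof.
rewrite big_mkcond/= (eq_bigr (fun j => (if j \in S then y j else 0) + 1)).
  rewrite bigA_distr [RHS]big_mkcond; apply: eq_bigr => S' _.
  case: ifPn => [/fintype.subsetP S'S|/fintype.subsetPn[j jS' jS]].
    by rewrite [RHS]big_mkcond; apply: eq_bigr => j _; case: ifP => // /S'S ->.
  by rewrite (bigD1 j)//= jS' (negbTE jS) mul0r.
by move=> j _; case: ifP => _; rewrite ?add0r// addrC.
Qed.

(** If [mu] is the law of a random set that contains the elements independently,
with probabilities [p], the mean over that set of a product of factors [1 + y j] is the
product of the means.  Expanding over subsets uses inclusion events only,
never the law of the whole set. *)
Lemma thinned_product (R : comPzRingType) (J : finType) (mu : {set J} -> R)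
    (p y : J -> R) :
  (forall S : {set J},
     \sum_(S' : {set J} | (S \subset S')%SET) mu S' = \prod_(j in S) p j)%R ->
  \sum_(S : {set J}) mu S * \prod_(j in S) (1 + y j) =
  \prod_j (1 + y j * p j).
Proof.
move=> mup.
have -> : \prod_j (1 + y j * p j) = \prod_(j in [set: J]%SET) (1 + y j * p j).
  by apply: eq_bigl => j; rewrite inE.
rewrite prod1D_subsets.
under eq_bigr do rewrite prod1D_subsets mulr_sumr.
rewrite (exchange_big_dep
  (fun S' : {set J} => (S' \subset [set: J])%SET))/=; last first.
  by move=> S S' _ _; exact: finset.subsetT.
apply: eq_bigr => S _; rewrite big_split/= -mup mulr_sumr.
by apply: eq_bigr => S' _; rewrite mulrC.
Qed.

Section sbm.
Context {R : realType} (n : nat) (lambda a b : R) (d : nat)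
  (G : geometric_sbm n lambda a b d).
Local Notation Omega := (gs_Omega G).
Local Notation P := (gs_P G).
Local Notation N := (@gs_N _ _ _ _ _ _ G).
Local Notation X := (@gs_X _ _ _ _ _ _ G).
Local Notation Z := (@gs_Z _ _ _ _ _ _ G).
Local Notation E := (@gs_E _ _ _ _ _ _ G).
Local Notation B := (torus_box R d n).

Lemma measurable_N k : measurable [set w | N w = k].
Proof.
have [mN _ _] := gs_ppp G.
by have := measurable_preimage mN (_ : measurable [set k]); apply.
Qed.

Lemma measurable_by_N (A : set Omega) :
  (forall k, measurable ([set w | N w = k] `&` A)) -> measurable A.
Proof.
move=> mA; rewrite (_ : A = \bigcup_k ([set w | N w = k] `&` A)).
  by apply: bigcupT_measurable.
by apply/seteqP; split => [w Aw|w [k _ []]//]; exists (N w).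
Qed.

Lemma measurable_locations k : measurable_fun setT (locations X k).
Proof.
have [_ mX _] := gs_ppp G; apply/measurable_fun_tnthP => i.
rewrite (_ : _ \o _ = X i)//.
by apply/funext => w /=; rewrite tnth_mktuple.
Qed.

Lemma measurable_locations_in k (A : set (k.-tuple (euclidean R d))) :
  measurable A -> measurable [set w | N w = k /\ A (locations X k w)].
Proof.
move=> mA; apply: measurableI; first exact: measurable_N.
exact: (measurable_preimage (@measurable_locations k) mA).
Qed.

Lemma measurable_labels k (z : 'I_k -> bool) :
  measurable [set w | forall i : 'I_k, Z i w = z i].
Proof.
apply: measurable_forall => i.
have := measurable_preimage (@gs_Z_measurable _ _ _ _ _ _ G i)
  (_ : measurable [set z i]).
by apply.
Qed.

Definition edge_bits_of k (w : Omega) : edge_bits k :=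
  [ffun e : 'I_k * 'I_k => (e.1 < e.2)%N && E w e.1 e.2].

Lemma measurable_edge_bits_of k (g : edge_bits k) :
  measurable [set w | edge_bits_of k w = g].
Proof.
have mE e : measurable [set w | edge_bits_of k w e = g e].
  rewrite (_ : [set w | _] = [set w | (e.1 < e.2)%N && E w e.1 e.2 = g e]).
    case: (e.1 < e.2)%N => /=.
      have := measurable_preimage (@gs_E_measurable _ _ _ _ _ _ G e.1 e.2)
        (_ : measurable [set g e]).
      by apply.
    by have [<-|ge] := eqVneq false (g e); [rewrite (_ : [set _ | _] = setT)|
      rewrite (_ : [set _ | _] = set0)];
      rewrite //; apply/seteqP; split => // w /= /eqP; rewrite (negbTE ge).
  by apply/seteqP; split => w /=; rewrite ffunE.
rewrite (_ : [set w | _] = [set w | forall e, edge_bits_of k w e = g e]).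
  exact: measurable_forall.
apply/seteqP; split => w /=; first by move=> ->.
by move=> h; apply/ffunP.
Qed.

Lemma upper_edge_bits_of k w : upper_bits (edge_bits_of k w).
Proof. by apply/forallP => e; rewrite ffunE; apply/implyP => /andP[]. Qed.

Lemma graph_of_edge_bits k w :
  graph_of_bits (edge_bits_of k w) = (fun i j : 'I_k => E w i j).
Proof.
apply/funext => i; apply/funext => j; rewrite /graph_of_bits !ffunE/=.
case: ltngtP => // ij; first by rewrite gs_E_sym.
by rewrite (val_inj ij) gs_E_irr.
Qed.

(** The number of points outside the box is Poisson of mean 0. *)
Lemma outside_box0 k (A : set (k.-tuple (euclidean R d))) : measurable A ->
  (forall x, A x -> exists i, ~ B (tnth x i)) ->
  P [set w | N w = k /\ A (locations X k w)] = 0%E.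
Proof.
move=> mA AB; have [_ _ ppp] := gs_ppp G.
have mC : measurable (~` B) by apply: measurableC; exact: measurable_torus_box.
have C0 :
    P [set w | forall i : 'I_1, point_count N X (~` B) w = 0%N] = 1%E.
  rewrite (ppp 1%N (fun=> ~` B) (fun=> 0%N))//; last first.
    by apply/trivIsetP => i j _ _; rewrite !ord1 eqxx.
  rewrite big_ord1 setICl measure0/= mulr0 /poisson_weight expr0 fact0 oppr0.
  by rewrite expR0 divr1 mulr1.
have mCount : measurable
    [set w | forall i : 'I_1, point_count N X (~` B) w = 0%N].
  apply: measurable_by_N => k'.
  rewrite (_ : _ `&` _ = [set w | N w = k' /\
     [set x : k'.-tuple (euclidean R d) | forall i, (~` (~` B)) (tnth x i)]
       (locations X k' w)]).
    apply: measurable_locations_in; apply: measurable_forall => i.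
    apply: (measurable_preimage (@measurable_tnth _ _ _ i)).
    exact: measurableC.
  apply/seteqP; split => w /= [Nw h]; split => //; subst k'.
    move=> i; rewrite tnth_mktuple => Xi.
    have := h ord0; rewrite /point_count => /eqP.
    by rewrite sum_nat_eq0 => /forallP/(_ i)/=; rewrite mem_set.
  move=> _; rewrite /point_count; apply: big1 => i _.
  by rewrite memNset//; have := h i; rewrite tnth_mktuple.
apply/eqP; rewrite eq_le measure_ge0 andbT.
have <- :
    P (~` [set w | forall i : 'I_1, point_count N X (~` B) w = 0%N]) = 0%E.
  by rewrite probability_setC// C0 subee.
apply: le_measure; rewrite ?inE;
  [exact: measurable_locations_in|exact: measurableC|].
move=> w [Nw Aw] /(_ ord0); subst k; have [i] := AB _ Aw.
rewrite tnth_mktuple => Xi /eqP; rewrite /point_count sum_nat_eq0.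
by move=> /forallP/(_ i)/=; rewrite mem_set.
Qed.

Lemma graph_prob_ext k (x y : k.-tuple (euclidean R d)) z g :
  (forall e, in_range n x e = in_range n y e) ->
  graph_prob a b n x z g = graph_prob a b n y z g.
Proof.
move=> xy; apply: eq_bigr => i _; apply: eq_bigr => j ij.
have := xy (i, j); rewrite /in_range /edge_range /= ij /= /edge_prob => ->.
by [].
Qed.

End sbm.

(** * Probability of recovery with separated sites *)

Section sites.
Context {R : realType} (n : nat) (lambda a b : R) (d : nat)
  (G : geometric_sbm n lambda a b d).
Hypotheses (b0 : 0 <= b) (ba : b < a) (a1 : a <= 1).
Context (J : finType) (c : J -> euclidean R d).
Local Notation r := (edge_range R d n).
Hypothesis r_gt0 : 0 < r.
Hypothesis rL : r + 1 < torus_side R d n / 4.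
Hypothesis cL : forall j i, `|(tnth (c j) i : R)| <= torus_side R d n / 4.
Hypothesis centres_sep : forall j j', j != j' ->
  exists i, 2 * (r + 1) < `|(tnth (c j) i : R) - (tnth (c j') i : R)|.
Context (m : J -> nat).

Local Notation Omega := (gs_Omega G).
Local Notation P := (gs_P G).
Local Notation N := (@gs_N _ _ _ _ _ _ G).
Local Notation X := (@gs_X _ _ _ _ _ _ G).
Local Notation Z := (@gs_Z _ _ _ _ _ _ G).
Local Notation E := (@gs_E _ _ _ _ _ _ G).
Local Notation B := (torus_box R d n).
Local Notation core := (core_cell c).
Local Notation shell := (shell_cell n c).

Definition good_sites k (x : k.-tuple (euclidean R d)) : {set J} :=
  [set j | (tuple_count (core j) x == 1%N) &&
           (tuple_count (shell j) x == m j)]%SET.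

Definition good_sites_of (w : Omega) : {set J} :=
  good_sites (locations X (N w) w).

Lemma measurable_core j : measurable (core j).
Proof. exact: measurable_cube. Qed.

Lemma measurable_shell j : measurable (shell j).
Proof.
by apply: measurableD; [exact: measurable_eball|exact: measurable_core].
Qed.

Lemma measurable_tuple_count k (A : set (euclidean R d)) (l : nat) :
  measurable A ->
  measurable [set x : k.-tuple (euclidean R d) | tuple_count A x = l].
Proof.
move=> mA.
rewrite (_ : [set _ | _] = [set x | exists s : {set 'I_k}, (#|s| = l /\
   forall i, (tnth x i \in A) = (i \in s))]).
  apply: measurable_exists => s.
  have [sl|sl] := eqVneq #|s| l; last first.
    rewrite (_ : (fun _ => _) = set0)//; apply/seteqP; split => // x [/eqP].
    by rewrite (negbTE sl).
  rewrite (_ : (fun _ => _) = [set x | forall i, (tnth x i \in A) = (i \in s)]).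
    apply: measurable_forall => i.
    pose coord (x : k.-tuple (euclidean R d)) := tnth x i.
    have mi : measurable (coord @^-1` A).
      by apply: measurable_preimage => //; exact: measurable_tnth.
    have [is_|is_] := boolP (i \in s).
      rewrite (_ : (fun _ => _) = coord @^-1` A) //.
      by apply/seteqP; split => [x /= /set_mem|x /= /mem_set].
    rewrite (_ : (fun _ => _) = ~` (coord @^-1` A)).
      exact: measurableC.
    apply/seteqP; split => [x /= xA /mem_set|x /= xA]; first by rewrite xA.
    by rewrite memNset// (negbTE is_).
  by apply/seteqP; split => x //= [].
apply/seteqP; split => [x /=|x /= [s [<- h]]]; rewrite tuple_countE.
  move=> <-; exists [set i : 'I_k | tnth x i \in A]%SET; split => // i.
  by rewrite finset.in_set.
by apply: eq_card => i; rewrite !inE h.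
Qed.

Lemma measurable_good_sites k (S : {set J}) :
  measurable [set x : k.-tuple (euclidean R d) | good_sites x = S].
Proof.
rewrite (_ : [set _ | _] = [set x | forall j, (j \in good_sites x) = (j \in S)]).
  apply: measurable_forall => j.
  have m1 : measurable [set x : k.-tuple (euclidean R d) | j \in good_sites x].
    rewrite (_ : [set _ | _] =
        [set x : k.-tuple (euclidean R d) | tuple_count (core j) x = 1%N] `&`
        [set x : k.-tuple (euclidean R d) | tuple_count (shell j) x = m j]).
      apply: measurableI; apply: measurable_tuple_count.
        exact: measurable_core.
      exact: measurable_shell.
    apply/seteqP; split => x /=; rewrite !finset.in_set.
      by move=> /andP[/eqP -> /eqP ->].
    by move=> [-> ->]; rewrite !eqxx.
  have [jS|jS] := boolP (j \in S); first exact: m1.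
  rewrite (_ : (fun _ => _) =
      ~` [set x : k.-tuple (euclidean R d) | j \in good_sites x]).
    exact: measurableC.
  by apply/seteqP; split => [x /= ->|x /= /negP/negbTE].
by apply/seteqP; split => [x /= ->|x /= h]//; apply/setP.
Qed.

Lemma measurable_in_range k (e : 'I_k * 'I_k) (v : bool) :
  measurable [set x : k.-tuple (euclidean R d) | in_range n x e = v].
Proof.
have m1 : measurable [set x : k.-tuple (euclidean R d) | in_range n x e].
  apply: measurable_pred; apply: measurable_and => //.
  by apply: measurable_fun_ler => //; apply: measurable_torus_dist;
    exact: measurable_tnth.
case: v => //.
rewrite (_ : [set _ | _] =
    ~` [set x : k.-tuple (euclidean R d) | in_range n x e]).
  exact: measurableC.
by apply/seteqP; split => [x /= ->|x /= /negP/negbTE].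
Qed.

Section estimator.
Context (tau : estimator R d) (mtau : measurable_estimator tau).

Let tau_bits k (x : k.-tuple (euclidean R d)) (g : edge_bits k) :
  bits 'I_k := [ffun i => tau x (graph_of_bits g) i].

(** Finitely many features of the locations determine the likelihoods, the
output of the estimator and the good sites.  Splitting the event [N = k]
according to them makes the conditional laws of labels and graph constant on
each part. *)
Let cellT k : finType := (bits ('I_k * 'I_k) *
  {ffun edge_bits k -> bits 'I_k} * {set J} * bool)%type.

Let cell k (x : k.-tuple (euclidean R d)) : cellT k :=
  ([ffun e => in_range n x e], [ffun g => tau_bits x g], good_sites x,
   `[< forall i, B (tnth x i) >]).

Let measurable_cell k (f : cellT k) : measurable [set x | cell x = f].
Proof.
case: f => [[[f1 f2] f3] f4].
rewrite (_ : [set x | _] =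
  [set x | forall e, in_range n x e = f1 e] `&`
  [set x : k.-tuple (euclidean R d) |
     forall g i, tau x (graph_of_bits g) i = f2 g i] `&`
  [set x | good_sites x = f3] `&`
  [set x : k.-tuple (euclidean R d) | `[< forall i, B (tnth x i) >] = f4]).
  apply: measurableI; [apply: measurableI; [apply: measurableI|]|].
  - by apply: measurable_forall => e; exact: measurable_in_range.
  - apply: measurable_forall => g; apply: measurable_forall => i.
    have := measurable_preimage (mtau (graph_of_bits g) i)
      (_ : measurable [set f2 g i]).
    by apply.
  - exact: measurable_good_sites.
  - pose inB := [set x : k.-tuple (euclidean R d) | forall i, B (tnth x i)].
    have m1 : measurable inB.
      apply: measurable_forall => i.
      apply: (measurable_preimage (@measurable_tnth _ _ _ i)).
      exact: measurable_torus_box.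
    case: f4.
      rewrite (_ : [set _ | _] = inB)//.
      by apply/seteqP; split => [x /= /asboolP|x /= ?]//; apply/asboolP.
    rewrite (_ : [set _ | _] = ~` inB).
      exact: measurableC.
    by apply/seteqP; split => [x /= /asboolP|x /= ?]//; apply/asboolP.
apply/seteqP; split => x /=.
  move=> [<- <- <- <-]; split => //; split => //; split => [e|g i];
  by rewrite !ffunE.
move=> [[[h1 h2] h3] h4]; rewrite /cell h3 h4; congr (_, _, _, _).
  by apply/ffunP => e; rewrite ffunE h1.
by apply/ffunP => g; apply/ffunP => i; rewrite !ffunE h2.
Qed.

Definition recovered (w : Omega) : Prop :=
  forall i : 'I_(N w), tau (locations X (N w) w)
    (fun i j : 'I_(N w) => E w i j) i = Z i w.

Let recovered_inE k w : N w = k -> recovered w <->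
  forall i : 'I_k, tau_bits (locations X k w) (edge_bits_of k w) i = Z i w.
Proof.
move=> Nw; subst k; rewrite /recovered; split => h i.
  by rewrite ffunE graph_of_edge_bits.
by rewrite -h ffunE graph_of_edge_bits.
Qed.

Lemma measurable_recovered : measurable [set w | recovered w].
Proof.
apply: measurable_by_N => k.
rewrite (_ : _ `&` _ = [set w | exists p : edge_bits k * bits 'I_k,
    ([set w | N w = k] `&` [set w | edge_bits_of k w = p.1] `&`
     ([set w | forall i : 'I_k, Z i w = p.2 i] `&`
      [set w | forall i : 'I_k,
         tau (locations X k w) (graph_of_bits p.1) i = p.2 i])) w]).
  apply: measurable_exists => -[g z] /=; apply: measurableI.
    by apply: measurableI; [exact: measurable_N|exact: measurable_edge_bits_of].
  apply: measurableI; first exact: measurable_labels.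
  apply: measurable_forall => i.
  have mi : measurable_fun setT
      ((fun x => tau x (graph_of_bits g) i) \o locations X k).
    by apply: measurableT_comp; [exact: mtau|exact: measurable_locations].
  by have := measurable_preimage mi (_ : measurable [set z i]); apply.
apply/seteqP; split => w.
  move=> [Nw /(recovered_inE Nw) rw].
  exists (edge_bits_of k w, [ffun i : 'I_k => Z i w]); split => //=.
  by split => i; rewrite /= ffunE// -rw ffunE.
move=> [[g z] /= [[/= Nw gw] [/= Zw tw]]]; split => //.
by apply/(recovered_inE Nw) => i; rewrite ffunE gw tw Zw.
Qed.

Let site_bound (S : {set J}) : R := \prod_(j in S) (1 - error_bound a b (m j)).

Let in_cell k (f : cellT k) : set Omega :=
  [set w | N w = k /\ cell (locations X k w) = f].

Let measurable_in_cell k (f : cellT k) : measurable (in_cell f).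
Proof.
exact: (@measurable_locations_in _ _ _ _ _ _ G k [set x | cell x = f]).
Qed.

Let recovered_cell_bits k (f : cellT k) (g : edge_bits k) :
  in_cell f `&` [set w | recovered w] `&` [set w | edge_bits_of k w = g] =
  if upper_bits g then
    [set w | [/\ N w = k, cell (locations X k w) = f,
                 forall i : 'I_k, Z i w = f.1.1.2 g i &
                 forall i j : 'I_k, (i < j)%N -> E w i j = graph_of_bits g i j]]
  else set0.
Proof.
case: ifPn => ug; last first.
  apply/seteqP; split => // w [_ /= gw].
  by rewrite -gw upper_edge_bits_of in ug.
apply/seteqP; split => w.
  move=> [[[Nw cw] /(recovered_inE Nw) rw] /= gw]; split => //.
    by move=> i; rewrite -rw gw -cw /= [in RHS]ffunE.
  by move=> i j ij; rewrite -gw graph_of_edge_bits.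
move=> [Nw cw Zw Ew]; have gw : edge_bits_of k w = g.
  apply/ffunP => -[i j]; rewrite ffunE /=.
  have [ij|ij] := boolP (i < j)%N; first by rewrite Ew// /graph_of_bits ij.
  by have /forallP/(_ (i, j)) := ug; rewrite (negbTE ij) implybF => /negbTE.
split => //; split => //; apply/(recovered_inE Nw) => i.
by rewrite gw Zw -cw /= [in RHS]ffunE.
Qed.

Let measurable_recovered_cell_bits k (f : cellT k) (g : edge_bits k) :
  measurable (in_cell f `&` [set w | recovered w] `&`
    [set w | edge_bits_of k w = g]).
Proof.
by apply: measurableI; [|exact: measurable_edge_bits_of];
  apply: measurableI => //; exact: measurable_recovered.
Qed.

Let measurable_recovered_cell k (f : cellT k) :
  measurable (in_cell f `&` [set w | recovered w]).
Proof. by apply: measurableI => //; exact: measurable_recovered. Qed.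

(** In one cell the probability of recovery is a sum over graphs, to which
the bound for fixed locations applies.  Cells with a point outside the box,
where that bound fails, are null. *)
Let recovered_cell_le k (f : cellT k) :
  (P (in_cell f `&` [set w | recovered w]) <=
   (site_bound f.1.2)%:E * P (in_cell f))%E.
Proof.
have [[x xf]|nox] := pselect (exists x, cell x = f); last first.
  rewrite (_ : in_cell f = set0) ?set0I ?measure0 ?mule0//.
  by apply/seteqP; split => // w [_ cw]; apply: nox; exists (locations X k w).
have [f4|f4] := boolP f.2; last first.
  have f0 : P (in_cell f) = 0%E.
    apply: (@outside_box0 _ _ _ _ _ _ G k [set x | cell x = f]).
      exact: measurable_cell.
    move=> y cy; apply/existsNP => yB; move/negP : f4; apply.
    by rewrite -cy /=; apply/asboolP.
  rewrite f0 mule0 -f0; apply: le_measure; rewrite ?inE//.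
rewrite (@measure_finpart _ _ _ _ _ (edge_bits_of k))//.
have -> : (\sum_(g : edge_bits k) P (in_cell f `&` [set w | recovered w] `&`
      [set w | edge_bits_of k w = g]) =
    \sum_(g | upper_bits g)
      (2^-1 ^+ k * graph_prob a b n x (f.1.1.2 g) (graph_of_bits g))%:E
        * P (in_cell f))%E.
  rewrite [RHS]big_mkcond/=; apply: eq_bigr => g _.
  rewrite recovered_cell_bits; case: ifPn => ug; last by rewrite measure0.
  have mcf := @measurable_cell k f.
  rewrite (@gs_edges _ _ _ _ _ _ G k _ (f.1.1.2 g) (graph_of_bits g) mcf).
  under eq_integral => w wD.
    have -> : graph_prob a b n (locations X k w) (f.1.1.2 g) (graph_of_bits g) =
        graph_prob a b n x (f.1.1.2 g) (graph_of_bits g).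
      apply: graph_prob_ext => e; move: wD; rewrite inE => -[_ cw _].
      have : (cell (locations X k w)).1.1.1 e = (cell x).1.1.1 e by rewrite cw xf.
      by rewrite !ffunE.
    over.
  rewrite integral_cst; last first.
    rewrite (_ : [set w | _] = in_cell f `&`
      [set w | forall i : 'I_k, Z i w = f.1.1.2 g i]).
      by apply: measurableI => //; exact: measurable_labels.
    by apply/seteqP; split => [w []|w [[]]].
  rewrite [X in (_ * X)%E = _](@gs_labels _ _ _ _ _ _ G k _ (f.1.1.2 g) mcf).
  by rewrite muleA -EFinM mulrC.
rewrite -ge0_sume_distrl; last first.
  move=> g _; rewrite lee_fin mulr_ge0 ?exprn_ge0 ?invr_ge0//.
  apply: prodr_ge0 => i _; apply: prodr_ge0 => j _; rewrite /edge_prob.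
  by case: ifP => _; case: ifP => _; try case: ifP => _; move: b0 ba a1; lra.
rewrite lee_wpmul2r ?measure_ge0// sumEFin lee_fin -mulr_sumr.
have f2E : f.1.1.2 = [ffun g => tau_bits x g] by rewrite -xf.
have f3E : f.1.2 = good_sites x by rewrite -xf.
apply: (located_success_le b0 ba a1 r_gt0 rL cL centres_sep).
  by move: f4; rewrite -xf /= => /asboolP.
by move=> j; rewrite f3E finset.in_set => /andP[/eqP ? /eqP ?].
Qed.

Let recovered_block_le k (S : {set J}) :
  (P ([set w | N w = k] `&`
      ([set w | recovered w] `&` [set w | good_sites_of w = S])) <=
   (site_bound S)%:E *
     P ([set w | N w = k] `&` [set w | good_sites_of w = S]))%E.
Proof.
have E1 (f : cellT k) : ([set w | N w = k] `&` [set w | good_sites_of w = S]) `&`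
    [set w | cell (locations X k w) = f] = if f.1.2 == S then in_cell f else set0.
  case: ifPn => [/eqP fS|/eqP fS]; apply/seteqP; split => //.
  - by move=> w [[]].
  - move=> w [Nw cw]; split => //; split => //=; rewrite /good_sites_of.
    by rewrite Nw -fS -cw.
  - move=> w [[/= Nw gw] /= cw]; apply: fS; rewrite -cw /= -gw /good_sites_of.
    by rewrite Nw.
have E2 (f : cellT k) :
    ([set w | N w = k] `&`
     ([set w | recovered w] `&` [set w | good_sites_of w = S]))
    `&` [set w | cell (locations X k w) = f] =
    if f.1.2 == S then in_cell f `&` [set w | recovered w] else set0.
  have := E1 f; set K := [set w | cell _ = f] => E1f.
  rewrite (_ : _ `&` K =
    ([set w | N w = k] `&` [set w | good_sites_of w = S] `&` K)
      `&` [set w | recovered w]); last first.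
    by apply/seteqP; split => w; [move=> [[? [? ?]] ?]|move=> [[[? ?] ?] ?]].
  by rewrite E1f; case: ifP => // _; rewrite set0I.
pose h w := cell (locations X k w).
rewrite (@measure_finpart _ _ _ _ _ h); last first.
  by move=> f; rewrite /= E2; case: ifP.
rewrite [in leRHS](@measure_finpart _ _ _ _ _ h); last first.
  by move=> f; rewrite /= E1; case: ifP.
rewrite ge0_sume_distrr//; apply: lee_sum => f _; rewrite /= E1 E2.
case: ifPn => [/eqP <-|_]; first exact: recovered_cell_le.
by rewrite measure0 mule0.
Qed.

Lemma measurable_good_sites_of (S : {set J}) :
  measurable [set w | good_sites_of w = S].
Proof.
apply: measurable_by_N => k.
rewrite (_ : _ `&` _ = [set w | N w = k /\
    [set x : k.-tuple (euclidean R d) | good_sites x = S] (locations X k w)]).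
  exact: (@measurable_locations_in _ _ _ _ _ _ G k _
    (@measurable_good_sites k S)).
by apply/seteqP; split => w /= [Nw]; subst k.
Qed.

Let measure_N (A : set Omega) : measurable A ->
  P A = (\sum_(k <oo) P ([set w | N w = k] `&` A))%E.
Proof.
move=> mA; rewrite -[in LHS](_ : \bigcup_k ([set w | N w = k] `&` A) = A).
  rewrite measure_bigcup//=; first by apply: eq_eseriesl => k; rewrite in_setT.
    by move=> k _; apply: measurableI => //; exact: measurable_N.
  apply/trivIsetP => k l _ _ kl; apply/seteqP; split => // w.
  move=> [[/= kw _] [/= lw _]].
  by move/eqP : kl; apply; rewrite -kw -lw.
by apply/seteqP; split => [w [k _ []]//|w Aw]; exists (N w).
Qed.

Let measurable_recovered_sites (S : {set J}) :
  measurable ([set w | recovered w] `&` [set w | good_sites_of w = S]).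
Proof.
by apply: measurableI;
  [exact: measurable_recovered|exact: measurable_good_sites_of].
Qed.

Let recovered_sites_le (S : {set J}) :
  (P ([set w | recovered w] `&` [set w | good_sites_of w = S]) <=
   (site_bound S)%:E * P [set w | good_sites_of w = S])%E.
Proof.
rewrite (measure_N (measurable_recovered_sites S)).
rewrite (measure_N (measurable_good_sites_of S)) -nneseriesZl; last first.
  by move=> k _; exact: measure_ge0.
by apply: lee_nneseries => k _ //; exact: recovered_block_le.
Qed.

Definition good_prob (j : J) : R :=
  poisson_weight (lambda * fine (lebesgue_euclidean R d (core j `&` B))) 1 *
  poisson_weight (lambda * fine (lebesgue_euclidean R d (shell j `&` B))) (m j).

(** The cores and shells of the sites of [S] are disjoint.  Sites outside [S]
contribute empty sets, whose count is 0 and whose Poisson weight at 0 is 1. *)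
Lemma good_sites_prob (S : {set J}) :
  P [set w | (S \subset good_sites_of w)%SET] = (\prod_(j in S) good_prob j)%:E.
Proof.
have [_ _ ppp] := gs_ppp G.
pose T : finType := (J * bool)%type.
pose A0 (t : T) :=
  if t.1 \in S then if t.2 then core t.1 else shell t.1 else set0.
pose c0 (t : T) : nat := if t.1 \in S then if t.2 then 1%N else m t.1 else 0%N.
have mA0 t : measurable (A0 t).
  rewrite /A0; case: ifP => // _; case: ifP => _; first exact: measurable_core.
  exact: measurable_shell.
have tA0 t t' : t != t' -> A0 t `&` A0 t' = set0.
  case: t t' => [j s] [j' s'] tt'; rewrite /A0 /=.
  have [jS|] := boolP (j \in S); last by rewrite set0I.
  have [j'S|] := boolP (j' \in S); last by rewrite setI0.
  apply/seteqP; split => // u [uj uj'].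
  have in_ball (i : J) (v : bool) : (if v then core i else shell i) u ->
      eball (c i) (r + 1) u.
    by case: v => [|[]//]; apply: cube_eball; rewrite lerDr ltW.
  have jj' := eball_site_inj r_gt0 centres_sep
    (in_ball _ _ uj) (in_ball _ _ uj').
  move: tt' uj uj'; rewrite -jj'; case: s => /=; case: s' => /=; rewrite ?eqxx//.
    by move=> _ ? [_].
  by move=> _ [_ ?].
pose A (i : 'I_#|T|) := A0 (enum_val i).
pose cc (i : 'I_#|T|) := c0 (enum_val i).
rewrite (_ : [set w | _] = [set w | forall i, point_count N X (A i) w = cc i]).
  rewrite ppp; last 2 first.
  - by move=> i; exact: mA0.
  - apply/trivIsetP => i i' _ _ ii'; apply: tA0.
    by apply: contra_neq ii' => /enum_val_inj.
  congr _%:E.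
  pose F t := poisson_weight
    (lambda * fine (lebesgue_euclidean R d (A0 t `&` B))) (c0 t).
  transitivity (\prod_(t : T) F t); first by rewrite -(big_enum_val F).
  rewrite -(pair_bigA _ (fun j s => F (j, s)))/= [RHS]big_mkcond/=.
  apply: eq_bigr => j _; rewrite big_bool/= /F /A0 /c0 /=; case: ifPn => // _.
  rewrite set0I measure0 /= mulr0 /poisson_weight expr0 fact0 oppr0 expR0.
  by rewrite divr1 !mulr1.
have countE w (A' : set (euclidean R d)) :
  point_count N X A' w = tuple_count A' (locations X (N w) w).
  rewrite /point_count /tuple_count; apply: eq_bigr => i _.
  by rewrite tnth_mktuple.
apply/seteqP; split => w /=.
  move=> /fintype.subsetP Sw i; rewrite /A /cc /A0 /c0.
  case: (enum_val i) => j s /=; case: ifPn => jS; last first.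
    by rewrite /point_count big1// => l _; rewrite memNset.
  have := Sw _ jS; rewrite finset.in_set => /andP[/eqP h1 /eqP h2].
  by rewrite countE; case: s.
move=> h; apply/fintype.subsetP => j jS; rewrite finset.in_set.
have h1 := h (enum_rank (j, true)); have h2 := h (enum_rank (j, false)).
move: h1 h2; rewrite /A /cc !enum_rankK /A0 /c0 /= jS !countE => -> ->.
by rewrite !eqxx.
Qed.

(** Each site is good independently with probability [good_prob], and each good
site costs a factor [1 - error_bound]; the random set of good sites is
integrated out by [thinned_product]. *)
Lemma recovered_le :
  (P [set w | recovered w] <=
   (\prod_j (1 - error_bound a b (m j) * good_prob j))%:E)%E.
Proof.
rewrite (@measure_finpart _ _ _ _ _ good_sites_of)//.
apply: (le_trans (lee_sum _ (fun S _ => recovered_sites_le S))).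
pose mu (S : {set J}) : R := fine (P [set w | good_sites_of w = S]).
have muE S : P [set w | good_sites_of w = S] = (mu S)%:E.
  by rewrite fineK// fin_num_measure//; exact: measurable_good_sites_of.
rewrite (eq_bigr (fun S => (mu S * site_bound S)%:E)); last first.
  by move=> S _; rewrite EFinM -muE muleC.
rewrite sumEFin lee_fin le_eqVlt; apply/orP; left; apply/eqP.
under [RHS]eq_bigr do rewrite -mulNr.
apply: (@thinned_product _ _ mu good_prob
  (fun j => - error_bound a b (m j))) => S.
apply: EFin_inj; rewrite -good_sites_prob.
rewrite (@measure_finpart _ _ _ _ _ good_sites_of).
  rewrite -sumEFin big_mkcond/=; apply: eq_bigr => S' _; case: ifPn => SS'.
    rewrite -muE; congr (P _); apply/seteqP; split => w /=; last by case.
    by move=> wS'; rewrite wS'.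
  rewrite (_ : _ `&` _ = set0) ?measure0//; apply/seteqP; split => // w.
  move=> [/= + wS'].
  by rewrite wS' (negbTE SS').
move=> S'; have [SS'|SS'] := boolP (S \subset S')%SET.
  rewrite (_ : _ `&` _ = [set w | good_sites_of w = S']).
    exact: measurable_good_sites_of.
  by apply/seteqP; split => w /=; [case|move=> wS'; rewrite wS'].
rewrite (_ : _ `&` _ = set0)//; apply/seteqP; split => // w [/= + wS'].
by rewrite wS' (negbTE SS').
Qed.

End estimator.
End sites.

(** * From overlap one to exact recovery *)

Lemma spinM (R : realType) (s t : bool) :
  spin R s * spin R t = if s == t then 1 else -1.
Proof. by case: s; case: t; rewrite /spin/= ?mulr1 ?mul1r ?mulrNN ?mulr1. Qed.

Lemma overlap_eq1 (R : realType) k (s z : 'I_k -> bool) :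
  overlap R s z = 1 <-> (forall i, s i = z i) \/ (forall i, ~~ s i = z i).
Proof.
rewrite /overlap; case: eqVneq => [k0|k0].
  split => // _; left => i; exfalso; have := ltn_ord i.
  by move: (i : nat) => l; rewrite k0.
have kn0 : k%:R != 0 :> R by rewrite pnatr_eq0.
(* Signs whose sum attains k or -k are all equal: the terms f i, each 0 or 2,
   sum to 0. *)
have allP (e : bool) : \sum_(i < k) spin R (s i) * spin R (z i) =
    (if e then 1 else -1) * k%:R <-> forall i, (s i == z i) = e.
  pose f (i : 'I_k) : R :=
    1 - (if e then 1 else -1) * (spin R (s i) * spin R (z i)).
  have fE i : f i = if (s i == z i) == e then 0 else 2.
    by rewrite /f spinM; case: (e); case: (_ == _) => /=; ring.
  have f0 i : 0 <= f i by rewrite fE; case: ifP.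
  have sumf : \sum_(i < k) f i =
      k%:R - (if e then 1 else -1) * \sum_(i < k) spin R (s i) * spin R (z i).
    by rewrite sumrB sumr_const card_ord mulr_sumr.
  have ee : (if e then 1 else -1) * (if e then 1 else -1) = 1 :> R.
    by case: (e); ring.
  split => [Se i|h].
    have : \sum_(i < k) f i == 0 by rewrite sumf Se mulrA ee mul1r subrr.
    rewrite psumr_eq0// => /allP/(_ i); rewrite mem_index_enum => /(_ isT).
    by rewrite fE; case: ifP => [/eqP|_]//=; rewrite pnatr_eq0.
  have : \sum_(i < k) f i = 0 by apply: big1 => i _; rewrite fE h eqxx.
  by rewrite sumf => /eqP; rewrite subr_eq0 => /eqP ->; rewrite mulrA ee mul1r.
split => [/(congr1 ( *%R k%:R))|[h|h]].
- rewrite mulrA mulfV// mul1r mulr1 => h.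
  have : `|\sum_(i < k) spin R (s i) * spin R (z i)| = `|k%:R|.
    by rewrite h ger0_norm.
  move/eqP; rewrite eqr_norm2 => /orP[/eqP h1|/eqP h1]; [left|right] => i.
    by apply/eqP; rewrite (proj1 (allP true)) ?mul1r.
  have := proj1 (allP false); rewrite mulN1r => /(_ h1 i).
  by case: (s i); case: (z i).
- have -> : \sum_(i < k) spin R (s i) * spin R (z i) = 1 * k%:R.
    by apply: (proj2 (allP true)) => i; rewrite h eqxx.
  by rewrite mul1r ger0_norm// mulVf.
- have -> : \sum_(i < k) spin R (s i) * spin R (z i) = -1 * k%:R.
    by apply: (proj2 (allP false)) => i; rewrite -h; case: (s i).
  by rewrite mulN1r normrN ger0_norm// mulVf.
Qed.

Section success.
Context {R : realType} (n : nat) (lambda a b : R) (d : nat)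
  (G : geometric_sbm n lambda a b d).

Definition flip_estimator (tau : estimator R d) : estimator R d :=
  fun k x g i => ~~ tau k x g i.

Lemma measurable_flip_estimator tau :
  measurable_estimator tau -> measurable_estimator (flip_estimator tau).
Proof. by move=> mtau k g i; apply: measurable_neg; exact: mtau. Qed.

Lemma success_le (tau : estimator R d) (x : R) : measurable_estimator tau ->
  (forall tau', measurable_estimator tau' ->
     measurable [set w | recovered (G := G) tau' w] /\
     (gs_P G [set w | recovered (G := G) tau' w] <= x%:E)%E) ->
  (gs_P G [set w | estimator_overlap tau w = 1%R] <= (2 * x)%:E)%E.
Proof.
move=> mtau h; have [m1 h1] := h _ mtau.
have [m2 h2] := h _ (measurable_flip_estimator mtau).
rewrite (_ : [set w | _] = [set w | recovered (G := G) tau w] `|`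
    [set w | recovered (G := G) (flip_estimator tau) w]).
  apply: (le_trans (measureU2 _ m1 m2)).
  by rewrite mulrDl mul1r EFinD leeD.
by apply/seteqP; split => w /=; rewrite /estimator_overlap overlap_eq1.
Qed.

End success.

(** * Poisson weights *)

Section poisson_weights.
Context {R : realType}.
Implicit Types (x mu rho : R) (m k : nat).

(** A weak form of Stirling's upper bound, by induction from
[e <= (1 + 1 / m)^(m + 1)]. *)
Lemma fact_expR_le m : (0 < m)%N ->
  m`!%:R * expR m%:R <= expR 1 * m%:R * m%:R ^+ m :> R.
Proof.
elim: m => // m IH _; have [->|m0] := posnP m.
  by rewrite factS fact0 muln1 expr1 !mulr1 mul1r.
have m0R : 0 < m%:R :> R by rewrite ltr0n.
have m1R : 0 < m.+1%:R :> R by rewrite ltr0n.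
have stepE : expR 1 * m%:R ^+ m.+1 <= m.+1%:R ^+ m.+1 :> R.
  have h : m%:R / m.+1%:R <= expR (- (m.+1%:R)^-1) :> R.
    rewrite (_ : _ / _ = 1 + - (m.+1%:R)^-1); first exact: expR_ge1Dx.
    by rewrite -natr1; field; rewrite natr1 gt_eqF.
  have : (m%:R / m.+1%:R) ^+ m.+1 <= expR (-1) :> R.
    apply: (@le_trans _ _ (expR (- (m.+1%:R)^-1) ^+ m.+1)).
      by rewrite ler_pXn2r ?nnegrE ?expR_ge0// divr_ge0.
    by rewrite -expRM_natl mulrN mulfV// gt_eqF.
  rewrite expr_div_n ler_pdivrMr ?exprn_gt0// => h2.
  have := ler_wpM2l (expR_ge0 1) h2.
  by rewrite mulrA -expRD subrr expR0 mul1r.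
rewrite factS natrM -[X in expR X]natr1 expRD.
set e := expR 1 in stepE IH *.
apply: (@le_trans _ _ (m.+1%:R * e * (e * m%:R * m%:R ^+ m))).
  rewrite (_ : _ * (_ * e) = m.+1%:R * e * (m`!%:R * expR m%:R)); last by ring.
  by rewrite ler_wpM2l ?mulr_ge0 ?expR_ge0// IH.
rewrite (_ : e * m%:R * _ = e * m%:R ^+ m.+1); last by rewrite exprS mulrA.
rewrite [X in _ <= X * _]mulrC.
by rewrite ler_wpM2l ?mulr_ge0 ?expR_ge0.
Qed.

(** The term of index [truncn x] is the largest of the exponential series. *)
Lemma pow_fact_ge x : 0 <= x ->
  expR (x - 2) / (x + 1) <= x ^+ Num.truncn x / (Num.truncn x)`!%:R.
Proof.
move=> x0; have /andP[mx xm] := truncn_itv x0; set m := Num.truncn x in mx xm *.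
have [m0|m0] := posnP m.
  rewrite m0 expr0 fact0 divr1 ler_pdivrMr ?ltr_wpDl// mul1r.
  apply: (@le_trans _ _ 1); last by rewrite lerDr.
  by rewrite -[leRHS]expR0 ler_expR; move: xm; rewrite m0; lra.
have m0R : 0 < m%:R :> R by rewrite ltr0n.
have xgt0 : 0 < x by apply: lt_le_trans mx.
have f0 : 0 < m`!%:R :> R by rewrite ltr0n fact_gt0.
rewrite ler_pdivrMr ?ltr_wpDl// mulrAC ler_pdivlMr//.
have := fact_expR_le m0 => h.
have h1 : expR (x - 2) <= expR (m%:R - 1).
  by rewrite ler_expR; move: xm; rewrite -natr1; lra.
have h2 : m%:R ^+ m <= x ^+ m by rewrite ler_pXn2r ?nnegrE.
apply: (@le_trans _ _ (expR (m%:R - 1) * m`!%:R)).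
  by rewrite ler_wpM2r// ltW.
apply: (@le_trans _ _ (m%:R ^+ m * m%:R)).
  rewrite expRB mulrAC ler_pdivrMr ?expR_gt0//.
  rewrite mulrC (_ : _ * expR 1 = expR 1 * m%:R * m%:R ^+ m) //; ring.
by apply: ler_pM => //; lra.
Qed.

Lemma poisson_weight_itv mu k : 0 <= mu -> 0 <= poisson_weight mu k <= 1.
Proof.
move=> mu0; rewrite /poisson_weight; apply/andP; split.
  by rewrite mulr_ge0 ?expR_ge0// divr_ge0 ?exprn_ge0.
rewrite expRN ler_pdivrMr ?expR_gt0// mul1r; case: k => [|k].
  by rewrite expr0 fact0 divr1 -[leLHS]expR0 ler_expR.
by apply: le_trans (expR_ge1Dxn k mu0); rewrite lerDr.
Qed.

(** The mean of [rho ^+ m] for [m] Poisson of mean [mu] is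
[exp (- (1 - rho) mu)]; its largest term, near [m = rho * mu], loses only a
factor linear in [mu]. *)
Lemma thinned_poisson_ge rho mu M : 0 <= rho <= 1 -> 0 <= mu <= M ->
  expR (- ((1 - rho) * M)) * expR (- 2) / (M + 1) <=
  rho ^+ Num.truncn (rho * mu) * poisson_weight mu (Num.truncn (rho * mu)).
Proof.
move=> /andP[rho0 rho1] /andP[mu0 muM].
have x0 : 0 <= rho * mu by rewrite mulr_ge0.
have := pow_fact_ge x0; set m := Num.truncn _ => h.
rewrite /poisson_weight !mulrA -exprMn.
apply: (@le_trans _ _
  (expR (rho * mu - 2) / (rho * mu + 1) * expR (- mu))); last first.
  by rewrite ler_wpM2r ?expR_ge0.
rewrite [leRHS]mulrAC -!expRD.
apply: ler_pM; rewrite ?expR_ge0 ?invr_ge0 ?addr_ge0//.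
- exact: le_trans muM.
- by rewrite ler_expR; nra.
- rewrite lef_pV2 ?posrE ?ltr_wpDl//; last exact: le_trans muM.
  by rewrite lerD2r; nra.
Qed.

Lemma truncn_thinned_le rho mu : 0 <= rho <= 1 -> 0 <= mu ->
  (Num.truncn (rho * mu))%:R <= mu.
Proof.
move=> /andP[rho0 rho1] mu0.
have /andP[h _] := truncn_itv (mulr_ge0 rho0 mu0).
by apply: (le_trans h); nra.
Qed.

End poisson_weights.

Lemma site_error_ge (R : realType) (a b mu M : R) :
  0 <= b -> b < a -> a <= 1 -> 0 <= mu <= M ->
  4^-1 * expR (- 2) * expR (- 2^-1) *
    expR (- ((1 - hellinger a b) * M)) *
    expR (- (max_llr a b * Num.sqrt (2 * M) / 2)) / (M + 1) <=
  error_bound a b (Num.truncn (hellinger a b * mu)) *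
  poisson_weight mu (Num.truncn (hellinger a b * mu)).
Proof.
move=> b0 ba a1 /andP[mu0 muM]; set m := Num.truncn _.
have rho01 : 0 <= hellinger a b <= 1 by rewrite hellinger_ge0 hellinger_le1.
have mmu : m%:R <= mu by exact: truncn_thinned_le.
have muMand : 0 <= mu <= M by rewrite mu0.
have := thinned_poisson_ge rho01 muMand; rewrite -/m.
rewrite /error_bound.
set p := poisson_weight _ _; set h := hellinger _ _ ^+ _.
set X := expR (- ((1 - _) * M)); set e2 := expR (- 2) => hp.
have ee : expR (- 2^-1) * expR (- (max_llr a b * Num.sqrt (2 * M) / 2)) <=
    expR (- ((max_llr a b * Num.sqrt (2 * m%:R) + 1) / 2)).
  rewrite -expRD ler_expR.
  have : Num.sqrt (2 * m%:R) <= Num.sqrt (2 * M).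
    have M0 : 0 <= M by exact: le_trans muM.
    by rewrite ler_sqrt ?mulr_ge0// ler_wpM2l// (le_trans mmu).
  by move/(ler_wpM2l (max_llr_ge0 a b)); lra.
have e0 : 0 <= expR (- 2^-1) * expR (- (max_llr a b * Num.sqrt (2 * M) / 2)).
  by rewrite mulr_ge0 ?expR_ge0.
have L0 : 0 <= X * e2 / (M + 1).
  by rewrite divr_ge0 ?mulr_ge0 ?expR_ge0 ?addr_ge0// (le_trans mu0).
have := ler_pM L0 e0 hp ee; set F := expR (- (_ / 2)) in ee e0 *.
set F' := expR (- (_ / 2)) => main.
rewrite (_ : 4^-1 * (h * F') * p = 4^-1 * (h * p * F')); last by ring.
apply: le_trans (ler_wpM2l _ main); last by rewrite invr_ge0.
by rewrite le_eqVlt; apply/orP; left; apply/eqP; ring.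
Qed.

(** * Asymptotics *)

Section grid.
Context {R : realType} (d g : nat) (L step : R).

Definition grid_centre (j : {ffun 'I_d -> 'I_g}) : euclidean R d :=
  [tuple - (L / 4) + step * (j i)%:R : measurableTypeR R | i < d].

Lemma grid_centre_bound j i : 0 <= step -> step * g%:R <= L / 2 ->
  `|(tnth (grid_centre j) i : R)| <= L / 4.
Proof.
move=> s0 sg; rewrite tnth_mktuple ler_norml.
have h1 : step * (j i)%:R <= step * g%:R.
  by rewrite ler_wpM2l// ler_nat ltnW.
have h0 : 0 <= step * (j i)%:R by rewrite mulr_ge0.
by apply/andP; split; lra.
Qed.

Lemma grid_centre_sep j j' : 0 <= step -> j != j' ->
  exists i,
    step <= `|(tnth (grid_centre j) i : R) - (tnth (grid_centre j') i : R)|.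
Proof.
move=> s0 jj'; have [i ji] : exists i, j i != j' i.
  apply/existsP; rewrite -negb_forall; apply: contraNN jj' => /forallP h.
  by apply/eqP/ffunP => i; apply/eqP.
exists i; rewrite !tnth_mktuple.
have -> : - (L / 4) + step * (j i)%:R - (- (L / 4) + step * (j' i)%:R) =
  step * ((j i)%:Z - (j' i)%:Z)%:~R by rewrite intrB; ring.
rewrite normrM ger0_norm// ler_peMr// -intr_norm ler1z.
by rewrite -gtz0_ge1 normr_gt0 subr_eq0.
Qed.

End grid.

Lemma prodr_le_expR (R : realType) (J : finType) (x : J -> R) (q : R) :
  (forall j, q <= x j <= 1) -> \prod_j (1 - x j) <= expR (- (#|J|%:R * q)).
Proof.
move=> qx; rewrite mulr_natl -mulNrn -mulr_natl expRM_natl -prodr_const.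
apply: ler_prod => j _; have /andP[h1 h2] := qx j.
rewrite subr_ge0 h2/=; apply: le_trans (expR_ge1Dx _); lra.
Qed.

Section scales.
Context {R : realType} (d n : nat).
Hypothesis d0 : (0 < d)%N.
Local Notation l := (ln n%:R : R).

Lemma powR_invn_exp (x : R) : 0 <= x -> (x `^ d%:R^-1) ^+ d = x.
Proof.
move=> x0; rewrite -powR_mulrn ?powR_ge0// -powRrM.
by rewrite mulVf ?pnatr_eq0 -?lt0n// powRr1.
Qed.

Lemma torus_side_exp : torus_side R d n ^+ d = n%:R.
Proof. exact: powR_invn_exp. Qed.

Lemma edge_range_exp : 0 <= l -> edge_range R d n ^+ d = l.
Proof. exact: powR_invn_exp. Qed.

Lemma ln_gt0_natr : 0 < l -> n%:R = expR l.
Proof.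
move=> l0; rewrite lnK// posrE.
by case: n l0 => [|k]; rewrite ?ltr0n// ln0 ?ltxx.
Qed.

Lemma edge_range_ge1 : 1 <= l -> 1 <= edge_range R d n.
Proof.
move=> l1; rewrite -(@ler_pXn2r _ d)// ?nnegrE ?powR_ge0//.
rewrite expr1n edge_range_exp//.
exact: le_trans l1.
Qed.

Lemma torus_side_ge : 1 <= l -> 2 * 20 ^+ d <= l ->
  20 * edge_range R d n <= torus_side R d n.
Proof.
move=> l1 l20; have l0 : 0 <= l by exact: le_trans l1.
rewrite -(@ler_pXn2r _ d)// ?nnegrE ?mulr_ge0 ?powR_ge0//.
rewrite exprMn edge_range_exp// torus_side_exp.
rewrite [leRHS]ln_gt0_natr ?(lt_le_trans ltr01)//.
apply: le_trans (expR_ge1Dxn 1 l0); rewrite (_ : 2`! = 2)%N// expr2.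
have := ler_wpM2r l0 l20; set p := 20 ^+ d; lra.
Qed.

(** [(1 + 1 / r)^d <= exp (d / r)]. *)
Lemma edge_range_succ_exp (e : R) : 0 < e -> 1 <= l ->
  (d%:R / ln (1 + e)) ^+ d <= l ->
  (edge_range R d n + 1) ^+ d <= (1 + e) * l.
Proof.
move=> e0 l1 hl; have r1 := edge_range_ge1 l1.
have l0 : 0 <= l by exact: le_trans l1.
set r := edge_range R d n in r1 *.
have r0 : 0 < r by exact: lt_le_trans r1.
have ln0 : 0 < ln (1 + e) by rewrite ln_gt0// ltrDl.
have dr : d%:R / ln (1 + e) <= r.
  rewrite -(@ler_pXn2r _ d)// ?nnegrE ?divr_ge0 ?(ltW ln0) ?(ltW r0)//.
  by rewrite edge_range_exp.
rewrite (_ : r + 1 = (1 + r^-1) * r); last by field; rewrite gt_eqF.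
rewrite exprMn edge_range_exp// ler_wpM2r//.
apply: (@le_trans _ _ (expR r^-1 ^+ d)).
  rewrite ler_pXn2r ?nnegrE ?expR_ge0 ?addr_ge0 ?invr_ge0 ?(ltW r0)//.
  exact: expR_ge1Dx.
rewrite -expRM_natl -[leRHS]lnK ?posrE ?addr_gt0// ler_expR.
by rewrite ler_pdivrMr// mulrC -ler_pdivrMr.
Qed.

End scales.

Lemma exp_beats_square (R : realType) (A K D x : R) :
  0 < K -> 0 < D -> 1 <= x -> 12 * A / (K * D ^+ 3) <= x -> 0 < A ->
  2 <= K / A * expR (D * x) / x ^+ 2.
Proof.
move=> K0 D0 x1 hx A0; have x0 : 0 < x by exact: lt_le_trans x1.
have Dx : 0 <= D * x by rewrite mulr_ge0 ?ltW.
have h : (D * x) ^+ 3 / 6 <= expR (D * x).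
  by apply: le_trans (expR_ge1Dxn 2 Dx); rewrite (_ : 3`! = 6)%N// lerDr.
rewrite ler_pdivlMr ?exprn_gt0//.
apply: (@le_trans _ _ (K / A * ((D * x) ^+ 3 / 6))); last first.
  by rewrite ler_wpM2l// divr_ge0 ?ltW.
have : 12 * A <= x * (K * D ^+ 3) by rewrite -ler_pdivrMr ?mulr_gt0 ?exprn_gt0.
move=> h2; rewrite mulrAC ler_pdivlMr//.
have := ler_wpM2r (sqr_ge0 x) h2; lra.
Qed.

Section converse.
Context {R : realType} (lambda a b : R) (d : nat).
Hypotheses (hlambda : 0 < lambda) (hd : (0 < d)%N).
Hypotheses (hb : 0 <= b) (hba : b < a) (ha : a <= 1).
Hypothesis hI : lambda * unit_ball_volume R d * (1 - hellinger a b) < 1.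

(** The mean number of points in a core. *)
Let core_mean : R := lambda * d%:R^-1 ^+ d.

Definition shell_mean n (J : finType) (c : J -> euclidean R d) (j : J) : R :=
  lambda * fine (lebesgue_euclidean R d (shell_cell n c j `&` torus_box R d n)).

(** Fewer points leave less evidence but are rarer; the compromise is the
dominant term in [thinned_poisson_ge]. *)
Definition shell_target n (J : finType) (c : J -> euclidean R d) (j : J) : nat :=
  Num.truncn (hellinger a b * shell_mean n c j).

Definition site_rate (M : R) : R :=
  poisson_weight core_mean 1 *
  (4^-1 * expR (- 2) * expR (- 2^-1) *
    expR (- ((1 - hellinger a b) * M)) *
    expR (- (max_llr a b * Num.sqrt (2 * M) / 2)) / (M + 1)).

(** The shell lies in the ball of radius [r + 1], which bounds its mean number
of points; the core lies in the box, so the mean number of its points is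
[core_mean]. *)
Lemma site_probability_ge n g (j : {ffun 'I_d -> 'I_g}) (step : R) M
    (c := grid_centre (torus_side R d n) step) :
  0 < edge_range R d n -> 4 <= torus_side R d n -> 0 <= step ->
  step * g%:R <= torus_side R d n / 2 ->
  lambda * (unit_ball_volume R d * (edge_range R d n + 1) ^+ d) <= M ->
  site_rate M <=
  error_bound a b (shell_target n c j) * good_prob n lambda c (shell_target n c) j
  <= 1.
Proof.
set r := edge_range R d n; set L := torus_side R d n => r0 L4 s0 sg hM.
set mu := shell_mean n c j; pose m := shell_target n c.
have coreE : core_cell c j `&` torus_box R d n = core_cell c j.
  apply/setIidl; apply: cube_box; first by rewrite -/L; lra.
  by move=> i; exact: grid_centre_bound.
have cmean : lambda * fine (lebesgue_euclidean R d
    (core_cell c j `&` torus_box R d n)) = core_mean.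
  by rewrite coreE lebesgue_cube// invr_gt0 ltr0n.
have m1 : measurable (core_cell c j) by exact: measurable_cube.
have m2 : measurable (eball (c j) (r + 1)) by exact: measurable_eball.
have m3 : measurable (shell_cell n c j `&` torus_box R d n).
  apply: measurableI; last exact: measurable_torus_box.
  exact: measurableD.
have mu0 : 0 <= mu by rewrite mulr_ge0 ?(ltW hlambda)// fine_ge0// measure_ge0.
have muM : mu <= M.
  apply: le_trans hM; rewrite ler_wpM2l ?(ltW hlambda)//.
  rewrite -[leRHS]/(fine (unit_ball_volume R d * (r + 1) ^+ d)%:E).
  have volE := @lebesgue_eball R d (c j) (r + 1) (addr_gt0 r0 ltr01).
  have le_vol : (lebesgue_euclidean R d (shell_cell n c j `&` torus_box R d n) <=
      (unit_ball_volume R d * (r + 1) ^+ d)%:E)%E.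
    rewrite -volE; apply: le_measure; rewrite ?inE//.
    by move=> u [[]].
  apply: fine_le => //; rewrite ge0_fin_numE ?measure_ge0//.
  by apply: (le_lt_trans le_vol); rewrite ltry.
have muand : 0 <= mu <= M by rewrite mu0.
have core0 : 0 <= poisson_weight core_mean 1 <= 1.
  apply: poisson_weight_itv.
  by rewrite mulr_ge0 ?(ltW hlambda)// exprn_ge0// invr_ge0.
have mu01 := poisson_weight_itv (m j) mu0.
rewrite -/m /good_prob cmean -/(shell_mean n c j) -/mu mulrCA; apply/andP; split.
  rewrite ler_wpM2l//; first by case/andP: core0.
  exact: site_error_ge.
have eb := error_bound_itv hb hba ha (m j).
case/andP: core0 => c0 c1; case/andP: mu01 => p0 p1; case/andP: eb => e0 e1.
apply: mulr_ile1 => //; first exact: mulr_ge0.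
exact: mulr_ile1.
Qed.

(** With [l = ln n], the grid has at least [exp l / (20^d l)] sites, each of
which is misleading with probability at least
[K exp (- (1 - 2 D) l - D l) / ((A + 1) l)], for constants [K] and [A] and a
gap [D > 0] that comes from [lambda nu_d (1 - rho) < 1].  Their product is
[exp (D l)] divided by a polynomial. *)
Lemma success_small : exists l0 : R, forall n, l0 <= ln n%:R ->
  forall (G : geometric_sbm n lambda a b d) (tau : estimator R d),
  measurable_estimator tau ->
  (gs_P G [set w | estimator_overlap tau w = 1%R] <= (2^-1)%:E)%E.
Proof.
have := hI; set nu := unit_ball_volume R d; set rho := hellinger a b => I1.
have nu0 : 0 <= nu by exact: unit_ball_volume_ge0.
have rho01 : 0 <= 1 - rho by rewrite subr_ge0 hellinger_le1.
pose I := lambda * nu * (1 - rho).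
have I0 : 0 <= I by rewrite !mulr_ge0// ltW.
pose e := (1 - I) / 2; pose D := (1 - I) / 4; pose A := (1 + e) * (lambda * nu).
have e0 : 0 < e by rewrite /e /I; lra.
have D0 : 0 < D by rewrite /D /I; lra.
have lnu0 : 0 <= lambda * nu by rewrite mulr_ge0 ?(ltW hlambda).
have A0 : 0 <= A by rewrite mulr_ge0// addr_ge0 ?(ltW e0).
pose C := max_llr a b; have C0 : 0 <= C by exact: max_llr_ge0.
have core_mean0 : 0 < core_mean by rewrite mulr_gt0// exprn_gt0// invr_gt0 ltr0n.
pose K := poisson_weight core_mean 1 * (4^-1 * expR (- 2) * expR (- 2^-1)).
have w0 : 0 < poisson_weight core_mean 1.
  by rewrite /poisson_weight expr1 divr1 pmulr_rgt0 ?expR_gt0.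
have K0 : 0 < K by rewrite pmulr_rgt0// !mulr_gt0 ?expR_gt0 ?invr_gt0.
have A10 : 0 < A + 1 by exact: ltr_wpDl.
have p20 : 0 < 20 ^+ d :> R by exact: exprn_gt0.
pose A' := 20 ^+ d * (A + 1).
have A'0 : 0 < A' by exact: mulr_gt0.
have ln1e : 0 < ln (1 + e) by rewrite ln_gt0// ltrDl.
pose t1 : R := (d%:R / ln (1 + e)) ^+ d.
pose t2 : R := 2 * 20 ^+ d.
pose t3 : R := C ^+ 2 * A / (2 * D ^+ 2).
pose t4 : R := 12 * A' / (K * D ^+ 3).
have t10 : 0 <= t1 by rewrite exprn_ge0// divr_ge0// ltW.
have t20 : 0 <= t2 by rewrite mulr_ge0// exprn_ge0.
have t30 : 0 <= t3 by rewrite divr_ge0// mulr_ge0// sqr_ge0.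
have t40 : 0 <= t4.
  by rewrite divr_ge0// mulr_ge0 ?exprn_ge0 ?(ltW A'0) ?(ltW K0) ?(ltW D0).
(* [t1] makes [(r + 1)^d <= (1 + e) l], [t2] makes the box 20 times wider than
   the range, [t3] absorbs the square root in the exponent, and [t4] lets the
   exponential beat the polynomial. *)
exists (1 + t1 + t2 + t3 + t4) => n hl G tau mtau; set l : R := ln n%:R in hl.
have l1 : 1 <= l by lra.
have lt1 : t1 <= l by lra.
have lt2 : t2 <= l by lra.
have lt3 : t3 <= l by lra.
have lt4 : t4 <= l by lra.
have l0 : 0 < l by exact: lt_le_trans l1.
pose r := edge_range R d n; pose L := torus_side R d n.
have r1 : 1 <= r by exact: edge_range_ge1.
have rL : 20 * r <= L by exact: torus_side_ge.
pose step := 2 * r + 3; have s0 : 0 < step by rewrite /step; lra.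
pose g := Num.truncn (L / (2 * step)).
have Ls0 : 0 <= L / (2 * step) by rewrite divr_ge0//; lra.
have /andP[gle glt] := truncn_itv Ls0; rewrite -/g in gle glt.
have sg : step * g%:R <= L / 2.
  by move: gle; rewrite ler_pdivlMr ?mulr_gt0//; lra.
have gge : L / (20 * r) <= g%:R.
  have r0 : 0 < r by lra.
  have h : L / (10 * r) <= L / (2 * step).
    by rewrite ler_wpM2l ?lef_pV2 ?posrE ?mulr_gt0// /step; lra.
  have h2 : 1 <= L / (20 * r) by rewrite ler_pdivlMr ?mulr_gt0// mul1r.
  have h3 : L / (10 * r) = 2 * (L / (20 * r)) by field; rewrite gt_eqF.
  move: glt h h2 h3; rewrite -natr1.
  set y := L / (20 * r); set u := L / (10 * r); set v := L / (2 * step); lra.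
pose J : finType := {ffun 'I_d -> 'I_g}.
have cardJ : expR l / (20 ^+ d * l) <= #|J|%:R.
  rewrite card_ffun !card_ord natrX.
  have -> : expR l / (20 ^+ d * l) = (L / (20 * r)) ^+ d.
    rewrite expr_div_n exprMn torus_side_exp// edge_range_exp ?(ltW l0)//.
    by rewrite -(ln_gt0_natr l0).
  have Lr0 : 0 <= L / (20 * r) by rewrite divr_ge0//; lra.
  by rewrite ler_pXn2r ?nnegrE.
pose c : J -> euclidean R d := grid_centre L step.
pose m := shell_target n c.
pose M := A * l.
have M0 : 0 <= M by exact: mulr_ge0 A0 (ltW l0).
have hM : lambda * (nu * (r + 1) ^+ d) <= M.
  have := edge_range_succ_exp hd e0 l1 lt1; rewrite -/r -/l => h.
  have := ler_wpM2l (_ : 0 <= lambda * nu) h; rewrite mulr_ge0 ?(ltW hlambda)//.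
  by move=> /(_ isT); rewrite /M /A -!mulrA (mulrCA (1 + e)) [nu * (_ * l)]mulrCA.
pose q := K * expR (- ((1 - rho) * M)) *
  expR (- (C * Num.sqrt (2 * M) / 2)) / (M + 1).
have qE : site_rate M = q by rewrite /site_rate /q /K -/C -/rho; ring.
have r0 : 0 < r by lra.
have L4 : 4 <= L by lra.
have sites j : q <= error_bound a b (m j) * good_prob n lambda c m j <= 1.
  by rewrite -qE; apply: site_probability_ge => //; exact: ltW.
have prod_small :
    \prod_(j : J) (1 - error_bound a b (m j) * good_prob n lambda c m j)
    <= 4^-1.
  apply: (le_trans (prodr_le_expR sites)).
  have Kq : 2 <= #|J|%:R * q.
    have := exp_beats_square K0 D0 l1 lt4 A'0 => h; apply: (le_trans h).
    have E1 : expR ((- (1 - 2 * D)) * l) <= expR (- ((1 - rho) * M)).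
      rewrite ler_expR mulNr lerN2 /M /A mulrA ler_wpM2r ?(ltW l0)//.
      rewrite (_ : _ * (_ * _) = (1 + e) * I); last by rewrite /I; ring.
      by have := sqr_ge0 (1 - I); rewrite /D /e; clearbody I => h2; lra.
    have E2 : expR (- (D * l)) <= expR (- (C * Num.sqrt (2 * M) / 2)).
      rewrite ler_expR lerN2 ler_pdivrMr//.
      have CM0 : 0 <= C * Num.sqrt (2 * M) by rewrite mulr_ge0 ?sqrtr_ge0.
      have Dl0 : 0 <= D * l * 2.
        exact: mulr_ge0 (mulr_ge0 (ltW D0) (ltW l0)) (ler0n _ 2).
      have M20 : 0 <= 2 * M by exact: mulr_ge0 (ler0n _ 2) M0.
      rewrite -(@ler_pXn2r _ 2) ?nnegrE// [leLHS]exprMn (sqr_sqrtr M20).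
      have D20 : 0 < 2 * D ^+ 2 by rewrite pmulr_rgt0// (exprn_gt0 2 D0).
      have := lt3; rewrite /t3 (ler_pdivrMr _ _ D20) => h3.
      by have := ler_wpM2r (ltW l0) h3; rewrite /M; clearbody A D; lra.
    have E3 : ((A + 1) * l)^-1 <= (M + 1)^-1.
      by rewrite lef_pV2 ?posrE ?mulr_gt0 ?ltr_wpDl// /M mulrDl mul1r lerD2l.
    have E0 : expR (D * l) =
        expR l * (expR ((- (1 - 2 * D)) * l) * expR (- (D * l))).
      by rewrite -!expRD; congr expR; ring.
    apply: (@le_trans _ _ (expR l / (20 ^+ d * l) *
       (K * (expR ((- (1 - 2 * D)) * l) * expR (- (D * l))) / ((A + 1) * l)))).
      rewrite E0 /A' le_eqVlt; apply/orP; left; apply/eqP; field.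
      by rewrite (gt_eqF l0) (gt_eqF A10) (gt_eqF p20).
    rewrite /q; apply: ler_pM => //.
    - exact: divr_ge0 (expR_ge0 _) (mulr_ge0 (ltW p20) (ltW l0)).
    - exact: divr_ge0 (mulr_ge0 (ltW K0) (mulr_ge0 (expR_ge0 _) (expR_ge0 _)))
        (mulr_ge0 (ltW A10) (ltW l0)).
    apply: ler_pM => //.
    - exact: mulr_ge0 (ltW K0) (mulr_ge0 (expR_ge0 _) (expR_ge0 _)).
    - by rewrite invr_ge0; exact: mulr_ge0 (ltW A10) (ltW l0).
    rewrite -mulrA ler_wpM2l ?(ltW K0)//.
    by apply: ler_pM; rewrite ?expR_ge0.
  apply: (@le_trans _ _ (expR (- 2))); first by rewrite ler_expR lerN2.
  rewrite expRN lef_pV2 ?posrE ?expR_gt0//.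
  have e1 : 2 <= expR 1 :> R by have := @expR_ge1Dx R 1; lra.
  rewrite (_ : 2 = 1 + 1 :> R)// expRD.
  have := ler_pM _ _ e1 e1; lra.
apply: (le_trans (@success_le _ _ _ _ _ _ _ _ 4^-1 mtau _)); last first.
  by rewrite lee_fin; lra.
have rL4 : r + 1 < L / 4 by lra.
have cL j i : `|(tnth (c j) i : R)| <= L / 4.
  by apply: grid_centre_bound => //; exact: ltW.
have csep j j' : j != j' ->
    exists i, 2 * (r + 1) < `|(tnth (c j) i : R) - (tnth (c j') i : R)|.
  move=> /(grid_centre_sep L (ltW s0))[i hi]; exists i.
  by apply: lt_le_trans hi; rewrite /step; lra.
move=> tau' mtau'; split; first exact: measurable_recovered.
apply: (le_trans (@recovered_le _ _ _ _ _ _ G hb hba ha J c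
  r0 rL4 cL csep m _ mtau')).
by rewrite lee_fin.
Qed.

End converse.

Theorem theorem4 (R : realType) (lambda a b : R) (d : nat)
    (hlambda : 0 < lambda) (hd : (0 < d)%N)
    (hb : 0 <= b) (hba : b < a) (ha : a <= 1)
    (hI : lambda * unit_ball_volume R d *
          (1 - Num.sqrt (a * b) - Num.sqrt ((1 - a) * (1 - b))) < 1)
    (G : forall n : nat, geometric_sbm n lambda a b d) :
  ~ exact_recovery_solvable G.
Proof.
move=> [tau mtau success].
have hI' : lambda * unit_ball_volume R d * (1 - hellinger a b) < 1.
  by rewrite /hellinger opprD addrA.
have [l0 small] := success_small hlambda hd hb hba ha hI'.
have : (1%E <= (2^-1 : R)%:E)%E.
  rewrite -(cvg_lim _ success)//; apply: lime_le.
    by apply/cvg_ex; exists 1%E.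
  near=> n; apply: small (mtau n).
  have h : expR l0 <= n%:R by near: n; exact: nbhs_infty_ger.
  have n0 : 0 < n%:R :> R by exact: lt_le_trans (expR_gt0 _) h.
  by rewrite -ler_expR lnK.
by rewrite lee_fin; lra.
Unshelve. all: by end_near.
Qed.
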